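(* Let $c,K>0$, $n\in\mathbb{N}^*$, let $\Omega\subset\mathbb{R}^n$ be non-empty, bounded and open, and let $A$ be a densely-defined, linear and self-adjoint operator in $L^2_{\mathbb{C}}(\Omega)$ with a pure point spectrum, i.e. for which there is a Hilbert basis $(e_k)_{k\in\mathbb{N}^*}$ of eigenvectors; for every $k\in\mathbb{N}^*$ let $\lambda_k$ be the eigenvalue corresponding to $e_k$. Let $\hat\Omega\supset\overline\Omega$ be bounded and open, and for every $k\in\mathbb{N}^*$ let $e_k$ be the restriction of some $\hat e_k\in C(\hat\Omega,\mathbb{C})$ satisfying $\|\hat e_k\|_\infty\leqslant K$. Let $f:\sigma(A)\to\mathbb{C}$ be bounded and universally measurable, $u\in L^2_{\mathbb{C}}(\Omega)$, and let $b:\mathbb{R}\to L^2_{\mathbb{C}}(\Omega)$ be continuous. (i) $f(A)$ is Hilbert–Schmidt if and only if $(|f(\lambda_k)|^2)_{k\in\mathbb{N}^*}$ is summable. (ii) If $f(A)$ is Hilbert–Schmidt, then $f(A)u$ has an extension to a continuous function on $\overline\Omega$, and for every limit point $x$ of $\Omega$ $$\lim_{y\to x}[f(A)u](y)=\sum_{k=1}^\infty f(\lambda_k)\langle e_k|u\rangle\Big(\lim_{y\to x}e_k(y)\Big).$$ (iii) Suppose in addition that $f$ is real-valued, $f(A)$ is Hilbert–Schmidt and $f(A)\leqslant c$. a) Then $v:\mathbb{R}\to L^2_{\mathbb{C}}(\Omega)$ defined for every $t\in\mathbb{R}$ by $$v(t):=\int_{I_t}\left[\overline{\frac{\sin((t-\tau)\sqrt{\phantom{x}})}{\sqrt{\phantom{x}}}}\bigg|_{\sigma(c-f(A))}\right](c-f(A))\,b(\tau)\,d\tau$$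 satisfies, for every $t\in\mathbb{R}$, $$v(t)=\sum_{k=1}^\infty\left\{\int_{I_t}\overline{\frac{\sin((t-\tau)\sqrt{\phantom{x}})}{\sqrt{\phantom{x}}}}\,(c-f(\lambda_k))\,\langle e_k|b(\tau)\rangle\,d\tau\right\}e_k .$$ b) Then for every $t\in\mathbb{R}$, $v(t)-v_c(t)$ has an extension to a continuous function on $\overline\Omega$, and for every limit point $x$ of $\Omega$ $$\lim_{y\to x}[v(t)-v_c(t)](y)=\sum_{k=1}^\infty\left\{\int_{I_t}\left[\overline{\frac{\sin((t-\tau)\sqrt{\phantom{x}})}{\sqrt{\phantom{x}}}}(c-f(\lambda_k))-\overline{\frac{\sin((t-\tau)\sqrt{\phantom{x}})}{\sqrt{\phantom{x}}}}(c)\right]\langle e_k|b(\tau)\rangle\,d\tau\right\}\Big(\lim_{y\to x}e_k(y)\Big),$$ where $v_c:\mathbb{R}\to L^2_{\mathbb{C}}(\Omega)$ is defined by $$v_c(t):=\int_{I_t}\overline{\frac{\sin((t-\tau)\sqrt{\phantom{x}})}{\sqrt{\phantom{x}}}}(c)\;b(\tau)\,d\tau .$$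
   Context: $\mathbb{N}^*=\{1,2,\dots\}$; $L^2_{\mathbb{C}}(\Omega)$ is the space of complex-valued square integrable functions with $\langle g|h\rangle=\int_\Omega g^*h$ ($^*$ is complex conjugation). $I_t:=[0,t]$ if $t\geqslant0$ and $I_t:=[t,0]$ if $t<0$. Integrals of $L^2_{\mathbb{C}}(\Omega)$-valued functions are weak integrals. For $s\in\mathbb{R}$, $\overline{\sin(s\sqrt{\phantom{x}})/\sqrt{\phantom{x}}}$ denotes the unique entire extension of $z\mapsto\sin(s\sqrt z)/\sqrt z$, i.e. $z\mapsto\sum_{k\ge0}(-1)^k\frac{s^{2k+1}}{(2k+1)!}z^k$; $\overline{\sin(s\sqrt{\phantom{x}})/\sqrt{\phantom{x}}}\,(\mu)$ is its value at $\mu$. Functions of self-adjoint operators are defined by the spectral theorem (bounded functional calculus); in particular $f(A)e_k=f(\lambda_k)e_k$ and $f(A)h=\sum_k f(\lambda_k)\langle e_k|h\rangle e_k$. $f(A)\leqslant c$ means $\langle h|f(A)h\rangle\leqslant c\|h\|^2$ for all $h$; scalars stand for multiples of the identity. ''An element of $L^2_{\mathbb{C}}(\Omega)$ has an extension to a continuous function on $\overline\Omega$'' means that it agrees a.e. on $\Omega$ with (the restriction of) a function continuous on $\overline\Omega$, and pointwise limits refer to this continuous representative. *)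

(* Defs.v *)
From HB Require Import structures.
From mathcomp Require Import all_boot all_order all_algebra.
From mathcomp Require Import generic_quotient ring_quotient complex ring lra.
From mathcomp Require Import all_classical all_reals all_analysis.
From mathcomp Require Import measurable_realfun.
Set Implicit Arguments.
Unset Strict Implicit.
Unset Printing Implicit Defensive.
Import Order.TTheory GRing.Theory Num.Theory.
Import numFieldNormedType.Exports.
Local Open Scope classical_set_scope.
Local Open Scope ring_scope.
Local Open Scope complex_scope.
Local Open Scope quotient_scope.

(* Without these, Re and Im are the numClosedFieldType versions, which are
   R[i]-valued. *)
Local Notation Re := (@complex.Re _).
Local Notation Im := (@complex.Im _).

(* Norms and distances over R[i] are R[i]-valued (with zero imaginary part). *)
HB.instance Definition _ (R : rcfType) := NormedModule.copy R[i] R[i]^o.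

Section image_measure.
Context d1 d2 (T1 : measurableType d1) (T2 : measurableType d2).
Context (R : realType).

Definition image_measure (m : {measure set T1 -> \bar R}) (f : T1 -> T2)
    (mf : measurable_fun setT f) : {measure set T2 -> \bar R} :=
  measure_function_pushforward__canonical__measure_function_Measure m mf.

End image_measure.

(* 'rV[R]_n, with its library topology (that of R^n), carries the Borel
   sigma-algebra. *)
Definition borel_display : measure_display -> measure_display.
Proof. exact. Qed.

Section borel_matrix.
Variables (R : realType) (m n : nat).
Let borel : set (set 'M[R]_(m, n)) := <<s (@open 'M[R]_(m, n)) >>.
Let borel0 : borel set0. Proof. exact: sigma_algebra0. Qed.
Let borelC A : borel A -> borel (~` A). Proof. exact: sigma_algebraC. Qed.
Let borelU (F : (set 'M[R]_(m, n))^nat) :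
  (forall i, borel (F i)) -> borel (\bigcup_i F i).
Proof. exact: sigma_algebra_bigcup. Qed.
HB.instance Definition _ :=
  @isMeasurable.Build (borel_display default_measure_display) 'M[R]_(m, n)
    borel borel0 borelC borelU.
End borel_matrix.

Lemma open_measurable_rV (R : realType) n (U : set 'rV[R]_n) :
  open U -> measurable U.
Proof. exact: sub_sigma_algebra. Qed.

Section lebesgue_measure_rV.
Variable R : realType.
Local Notation RR := (measurableTypeR R).

Let cons_tuple n (z : RR * n.-tuple RR) : n.+1.-tuple RR :=
  [tuple of z.1 :: z.2].

Let measurable_cons_tuple n : measurable_fun setT (@cons_tuple n).
Proof. by apply: measurable_cons. Qed.

Let uncons_tuple n (t : n.+1.-tuple RR) : RR * n.-tuple RR :=
  (thead t, [tuple of behead t]).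

Let measurable_uncons_tuple n : measurable_fun setT (@uncons_tuple n).
Proof.
apply: measurable_fun_pair; first exact: (measurable_tnth ord0).
exact: measurable_behead.
Qed.

Let consK n (z : RR * n.-tuple RR) : uncons_tuple (cons_tuple z) = z.
Proof. by case: z => a t; congr (_, _); apply/val_inj. Qed.

Section cons_measure.
Variables (n : nat) (m : {sigma_finite_measure set (n.-tuple RR) -> \bar R}).
Let cons_measure : set (n.+1.-tuple RR) -> \bar R :=
  image_measure (lebesgue_measure \x m)%E (@measurable_cons_tuple n).

HB.instance Definition _ := Measure.on cons_measure.

Let sigma_finite_cons_measure : sigma_finite setT cons_measure.
Proof.
have /sigma_finiteP[F [TF ndF Foo]] :=
  sigma_finiteT (@lebesgue_measure R : {sigma_finite_measure set RR -> \bar R}).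
have /sigma_finiteP[G [TG ndG Goo]] := sigma_finiteT m.
exists (fun k => @uncons_tuple n @^-1` (F k `*` G k)).
  apply/esym/seteqP; split=> // t _.
  have [i _ Fi] : (\bigcup_k F k) (thead t) by rewrite -TF.
  have [j _ Gj] : (\bigcup_k G k) [tuple of behead t] by rewrite -TG.
  exists (maxn i j) => //; split => /=.
    by move: Fi; exact/subsetPset/ndF/leq_maxl.
  by move: Gj; exact/subsetPset/ndG/leq_maxr.
move=> k; have [mF Fk] := Foo k; have [mG Gk] := Goo k; split.
  rewrite -[X in measurable X]setTI; apply: measurable_uncons_tuple => //.
  exact: measurableX.
rewrite /cons_measure/= /pushforward -comp_preimage.
rewrite (_ : _ \o _ = id); last by apply/funext => z /=; exact: consK.
by rewrite preimage_id product_measure1E// lte_mul_pinfty// ge0_fin_numE.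
Qed.

HB.instance Definition _ := Measure_isSigmaFinite.Build _ _ _ cons_measure
  sigma_finite_cons_measure.

Definition cons_lebesgue : {sigma_finite_measure set _ -> \bar R} :=
  cons_measure.
End cons_measure.

(* The n-fold product of the one-dimensional Lebesgue measure. *)
Fixpoint lebesgue_tuple n :
    {sigma_finite_measure set (n.-tuple RR) -> \bar R} :=
  if n is n'.+1 then cons_lebesgue (lebesgue_tuple n') else dirac [tuple].

Definition row_of_tuple n (t : n.-tuple RR) : 'rV[R]_n := \row_i tnth t i.

Let box n (ab : 'rV[rat]_n * 'rV[rat]_n) : set 'rV[R]_n :=
  [set y | forall i, ratr (ab.1 ord0 i) < y ord0 i < ratr (ab.2 ord0 i)].

Let open_box n (U : set 'rV[R]_n) : open U ->
  U = \bigcup_(ab in [set ab | box ab `<=` U]) box ab.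
Proof.
move=> oU; apply/seteqP; split=> [y Uy|y [ab abU]]; last exact: abU.
have /nbhs_ballP[/= e e0 yeU] := open_nbhs_nbhs (conj oU Uy).
have rata i : exists q : rat, ratr q \in `]y ord0 i - e, y ord0 i[.
  by have [|q qP] := @rat_in_itvoo R (y ord0 i - e) (y ord0 i);
    [rewrite ltrBlDr ltrDl|exists q].
have ratb i : exists q : rat, ratr q \in `]y ord0 i, y ord0 i + e[.
  by have [|q qP] := @rat_in_itvoo R (y ord0 i) (y ord0 i + e);
    [rewrite ltrDl|exists q].
have [a aP] := choice rata; have [b bP] := choice ratb.
exists (\row_i a i, \row_i b i); last first.
  move=> i /=; rewrite !mxE; have := aP i; have := bP i; rewrite !in_itv/=.
  by move=> /andP[-> _] /andP[_ ->].
move=> z zab; apply: yeU; split => // i j; rewrite ord1 /ball/=.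
have := zab j; rewrite /= !mxE => /andP[az zb].
have := aP j; have := bP j; rewrite !in_itv/= => /andP[_ be] /andP[ea _].
rewrite ltr_norml; apply/andP; split.
  by rewrite ltrBrDl ltrBlDr; exact: lt_trans be.
by rewrite ltrBlDr -ltrBlDl; exact: lt_trans az.
Qed.

Lemma measurable_row_of_tuple n : measurable_fun setT (@row_of_tuple n).
Proof.
apply: (@measurability _ _ _ _ _ _ (@open 'rV[R]_n)) => //.
move=> _ [U oU <-]; rewrite setTI (open_box oU) preimage_bigcup bigcup_mkcond.
apply: countable_bigcupT_measurable => [|ab]; first exact: countableP.
case: ifPn => // _.
rewrite (_ : _ @^-1` _ = \bigcap_(i in [set: 'I_n])
    ((@tnth n RR ^~ i) @^-1` `]ratr (ab.1 ord0 i), ratr (ab.2 ord0 i)[)).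
  apply: fin_bigcap_measurable => // i _.
  by rewrite -[X in measurable X]setTI; exact: measurable_tnth.
apply/seteqP; split=> t /= tab i.
  by have := tab i; rewrite mxE /= in_itv.
by have := tab i I; rewrite /= mxE in_itv.
Qed.

Definition lebesgue_rV n : {measure set 'rV[R]_n -> \bar R} :=
  image_measure (lebesgue_tuple n) (@measurable_row_of_tuple n).

End lebesgue_measure_rV.

Section complex_integral.
Context d (T : measurableType d) (R : realType).
Variable mu : {measure set T -> \bar R}.
Implicit Types (D : set T) (f g : T -> R[i]).

Definition cmeasurable f :=
  measurable_fun [set: T] (fun x => Re (f x)) /\
  measurable_fun [set: T] (fun x => Im (f x)).

Definition cintegrable D f :=
  mu.-integrable D (fun x => (Re (f x))%:E) /\
  mu.-integrable D (fun x => (Im (f x))%:E).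

Definition cintegral D f : R[i] :=
  (\int[mu]_(x in D) Re (f x)) +i* (\int[mu]_(x in D) Im (f x)).

Definition square_integrable f :=
  cmeasurable f /\ (\int[mu]_x (Normc.normc (f x) ^+ 2)%:E < +oo)%E.

Let sqrNormc (z : R[i]) : Normc.normc z ^+ 2 = Re z ^+ 2 + Im z ^+ 2.
Proof. by case: z => a b /=; rewrite sqr_sqrtr// addr_ge0// sqr_ge0. Qed.

Lemma square_integrableP f : square_integrable f <->
  cmeasurable f /\ mu.-integrable setT (fun x => (Re (f x) ^+ 2 + Im (f x) ^+ 2)%:E).
Proof.
split=> -[[mr mi] h]; split=> //.
  apply/integrableP; split.
    apply/measurable_EFinP; apply: measurable_funD; exact: measurable_funX.
  apply: le_lt_trans h; apply: ge0_le_integral => //.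
  - apply/measurable_EFinP/measurableT_comp => //.
    apply: measurable_funD; exact: measurable_funX.
  - apply/measurable_EFinP; under eq_fun do rewrite sqrNormc.
    apply: measurable_funD; exact: measurable_funX.
  - by move=> x _; rewrite lee_fin sqrNormc ger0_norm// addr_ge0// sqr_ge0.
have /integrableP[_] := h; apply: le_lt_trans.
under eq_integral do rewrite sqrNormc.
apply: ge0_le_integral => //.
- by move=> x _; rewrite lee_fin addr_ge0// sqr_ge0.
- by apply/measurable_EFinP; apply: measurable_funD; exact: measurable_funX.
- apply/measurable_EFinP/measurableT_comp => //.
  by apply: measurable_funD; exact: measurable_funX.
- by move=> x _; rewrite lee_fin ler_norm.
Qed.

Lemma square_integrable0 : square_integrable (0 : T -> R[i]).
Proof.
split; first by split; exact: measurable_cst.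
by under eq_integral do rewrite /= expr0n addr0 sqrtr0 expr0n; rewrite integral0.
Qed.

Let cmeasurable_lin (a : R[i]) f g : cmeasurable f -> cmeasurable g ->
  cmeasurable (fun x => a * f x + g x).
Proof.
case: a => a b [fr fi] [gr gi]; split.
- rewrite (_ : (fun _ => _) = (fun x => a * Re (f x) - b * Im (f x) + Re (g x))).
    by apply: measurable_funD => //; apply: measurable_funB => //;
      apply: measurable_funM.
  by apply/funext => x; case: (f x) (g x) => [? ?] [? ?].
- rewrite (_ : (fun _ => _) = (fun x => a * Im (f x) + b * Re (f x) + Im (g x))).
    by apply: measurable_funD => //; apply: measurable_funD => //;
      apply: measurable_funM.
  by apply/funext => x; case: (f x) (g x) => [? ?] [? ?].
Qed.

Lemma square_integrable_lin (a : R[i]) f g :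
  square_integrable f -> square_integrable g ->
  square_integrable (fun x => a * f x + g x).
Proof.
move=> /square_integrableP[mf hf] /square_integrableP[mg hg].
have mfg := cmeasurable_lin a mf mg.
apply/square_integrableP; split => //.
set F := (fun x => (Re (f x) ^+ 2 + _)%:E) in hf.
set G := (fun x => (Re (g x) ^+ 2 + _)%:E) in hg.
pose k := 2 * (Re a ^+ 2 + Im a ^+ 2).
apply: (@le_integrable _ _ _ mu _ measurableT _
  ((fun x => k%:E * F x) \+ (fun x => 2%:E * G x))%E).
- apply/measurable_EFinP; case: mfg => m1 m2.
  by apply: measurable_funD; exact: measurable_funX.
- move=> x _; rewrite /F /G /k /= lee_fin.
  case: (f x) (g x) => [p q] [r s]; case: a {mfg k} => a b /=.
  rewrite ger0_norm ?addr_ge0 ?sqr_ge0// ger0_norm; last first.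
    by rewrite addr_ge0// mulr_ge0 ?mulr_ge0 ?addr_ge0 ?sqr_ge0.
  have h0 := sqr_ge0 (a * p - b * q - r).
  have h1 := sqr_ge0 (a * q + b * p - s).
  nra.
- by apply: integrableD => //; exact: integrableZl.
Qed.

Definition conj_mul f g x : R[i] := (f x)^*%C * g x.

Lemma cintegrable_conj_mul f g : square_integrable f -> square_integrable g ->
  cintegrable setT (conj_mul f g).
Proof.
move=> /square_integrableP[[fr fi] hf] /square_integrableP[[gr gi] hg].
set F := (fun x => (Re (f x) ^+ 2 + _)%:E) in hf.
set G := (fun x => (Re (g x) ^+ 2 + _)%:E) in hg.
have FG : mu.-integrable setT (F \+ G)%E by exact: integrableD.
split; apply: le_integrable FG => //.
- apply/measurable_EFinP; rewrite (_ : (fun _ => _) =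
    (fun x => Re (f x) * Re (g x) + Im (f x) * Im (g x))).
    by apply: measurable_funD => //; apply: measurable_funM.
  by apply/funext => x; rewrite /conj_mul; case: (f x) (g x) => [? ?] [? ?] /=;
    rewrite mulNr opprK.
- move=> x _; rewrite /F /G /conj_mul /= lee_fin.
  case: (f x) (g x) => [p q] [r s] /=.
  rewrite [leRHS]ger0_norm ?addr_ge0 ?sqr_ge0// ler_norml.
  have := sqr_ge0 (p - r); have := sqr_ge0 (q - s).
  have := sqr_ge0 (p + r); have := sqr_ge0 (q + s).
  have := sqr_ge0 p; have := sqr_ge0 q; have := sqr_ge0 r; have := sqr_ge0 s.
  by move=> *; apply/andP; split; nra.
- apply/measurable_EFinP; rewrite (_ : (fun _ => _) =
    (fun x => Re (f x) * Im (g x) - Im (f x) * Re (g x))).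
    by apply: measurable_funB => //; apply: measurable_funM.
  by apply/funext => x; rewrite /conj_mul; case: (f x) (g x) => [? ?] [? ?] /=;
    rewrite mulNr.
- move=> x _; rewrite /F /G /conj_mul /= lee_fin.
  case: (f x) (g x) => [p q] [r s] /=.
  rewrite [leRHS]ger0_norm ?addr_ge0 ?sqr_ge0// ler_norml.
  have := sqr_ge0 (p - s); have := sqr_ge0 (q - r).
  have := sqr_ge0 (p + s); have := sqr_ge0 (q + r).
  have := sqr_ge0 p; have := sqr_ge0 q; have := sqr_ge0 r; have := sqr_ge0 s.
  by move=> *; apply/andP; split; nra.
Qed.

Lemma cintegral_lin D (a : R[i]) f g : measurable D ->
  cintegrable D f -> cintegrable D g ->
  cintegral D (fun x => a * f x + g x) = a * cintegral D f + cintegral D g.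
Proof.
move=> mD [fr fi] [gr gi]; case: a => a b; rewrite /cintegral.
have Z c h : mu.-integrable D (fun x => (h x)%:E) ->
    mu.-integrable D (EFin \o (fun x => c * h x)).
  by move=> hi; apply: eq_integrable (integrableZl mD c hi) => // x _; rewrite EFinM.
congr (_ +i* _).
- under eq_Rintegral => x _.
    rewrite (_ : Re _ = a * Re (f x) + (- b) * Im (f x) + Re (g x)); last first.
      by case: (f x) (g x) => [? ?] [? ?] /=; rewrite mulNr.
    over.
  rewrite RintegralD//; last first.
    by apply: eq_integrable (integrableD mD (Z a _ fr) (Z (- b) _ fi)).
  rewrite RintegralD//; [|exact: Z|exact: Z].
  by rewrite RintegralZl// RintegralZl// mulNr.
- under eq_Rintegral => x _.
    rewrite (_ : Im _ = a * Im (f x) + b * Re (f x) + Im (g x)); last first.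
      by case: (f x) (g x) => [? ?] [? ?] /=.
    over.
  rewrite RintegralD//; last first.
    by apply: eq_integrable (integrableD mD (Z a _ fi) (Z b _ fr)).
  rewrite RintegralD//; [|exact: Z|exact: Z].
  by rewrite RintegralZl// RintegralZl.
Qed.

Lemma cintegral_conj D f : measurable D -> cintegrable D f ->
  cintegral D (fun x => (f x)^*%C) = (cintegral D f)^*%C.
Proof.
move=> mD [fr fi]; rewrite /cintegral/=; congr (_ +i* _).
  by apply: eq_Rintegral => x _; case: (f x).
under eq_Rintegral => x _.
  rewrite (_ : Im _ = (-1) * Im (f x)); last by case: (f x) => ? ? /=; rewrite mulN1r.
  over.
by rewrite RintegralZl// mulN1r.
Qed.

Lemma ae_eq_cintegral D f g : measurable D ->
  cmeasurable f -> cmeasurable g ->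
  f = g %[ae mu in D] -> cintegral D f = cintegral D g.
Proof.
move=> mD [fr fi] [gr gi] fg; rewrite /cintegral; congr (_ +i* _); congr fine.
  apply: ae_eq_integral => //.
  - by apply: measurable_funTS; exact/measurable_EFinP.
  - by apply: measurable_funTS; exact/measurable_EFinP.
  - by apply: filterS fg => x h Dx; rewrite h.
apply: ae_eq_integral => //.
- by apply: measurable_funTS; exact/measurable_EFinP.
- by apply: measurable_funTS; exact/measurable_EFinP.
- by apply: filterS fg => x h Dx; rewrite h.
Qed.

Lemma cmeasurable_conj_mul f g : cmeasurable f -> cmeasurable g ->
  cmeasurable (conj_mul f g).
Proof.
move=> [fr fi] [gr gi]; split.
- rewrite (_ : (fun _ => _) =
    (fun x => Re (f x) * Re (g x) + Im (f x) * Im (g x))).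
    by apply: measurable_funD => //; apply: measurable_funM.
  by apply/funext => x; rewrite /conj_mul; case: (f x) (g x) => [? ?] [? ?] /=;
    rewrite mulNr opprK.
- rewrite (_ : (fun _ => _) =
    (fun x => Re (f x) * Im (g x) - Im (f x) * Re (g x))).
    by apply: measurable_funB => //; apply: measurable_funM.
  by apply/funext => x; rewrite /conj_mul; case: (f x) (g x) => [? ?] [? ?] /=;
    rewrite mulNr.
Qed.

End complex_integral.

Section L2_space.
Context d (T : measurableType d) (R : realType).
Variable mu : {measure set T -> \bar R}.

Let sqint : {pred T -> R[i]} := mem [set f | square_integrable mu f].

Let sqintP (f : T -> R[i]) : reflect (square_integrable mu f) (f \in sqint).
Proof. by apply: (iffP idP); rewrite /sqint inE. Qed.

Let sqint_submod : submod_closed sqint.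
Proof.
split=> [|a f g /sqintP hf /sqintP hg]; apply/sqintP.
  exact: square_integrable0.
exact: square_integrable_lin.
Qed.
HB.instance Definition _ := GRing.isSubmodClosed.Build _ _ sqint sqint_submod.

Record L2fun := MkL2fun { L2fun_val :> T -> R[i]; _ : L2fun_val \in sqint }.
HB.instance Definition _ := [isSub for L2fun_val].
HB.instance Definition _ := [Choice of L2fun by <:].
HB.instance Definition _ := [SubChoice_isSubLmodule of L2fun by <:].

Let valB (f g : L2fun) x : (f - g) x = f x - g x.
Proof. by []. Qed.
Let valD (f g : L2fun) x : (f + g) x = f x + g x.
Proof. by []. Qed.
Let valZ a (f : L2fun) x : (a *: f) x = a * f x.
Proof. by []. Qed.

Lemma L2funP (f : L2fun) : square_integrable mu f.
Proof. by apply/sqintP; case: f. Qed.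

Let null : {pred L2fun} := mem [set f : L2fun | f = cst 0 %[ae mu in setT]].

Let nullP (f : L2fun) : reflect (f = cst 0 %[ae mu in setT]) (f \in null).
Proof. by apply: (iffP idP); rewrite /null inE. Qed.

Let null_zmod : zmod_closed null.
Proof.
split=> [|f g /nullP hf /nullP hg]; apply/nullP; first exact: aeW.
by apply: filterS2 hf hg => x hf hg xT; rewrite valB hf// hg// subr0.
Qed.
HB.instance Definition _ := GRing.isZmodClosed.Build _ null null_zmod.

(* Elements are classes, modulo mu-a.e. equality, of square integrable functions
   defined on all of T; L2_fun picks a representative. *)
Definition L2 := Quotient.quot null.
HB.instance Definition _ := GRing.Zmodule.on L2.
HB.instance Definition _ : EqQuotient L2fun (Quotient.equiv null) L2 :=
  EqQuotient.on L2.

Let modP (f g : L2fun) :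
  reflect (f = g %[ae mu in setT]) (f == g %[mod L2]).
Proof.
rewrite -Quotient.idealrBE; apply: (iffP (nullP _)) => h.
  by apply: filterS h => x h xT; apply/eqP; rewrite -subr_eq0 -valB h.
by apply: filterS h => x h xT; rewrite valB h// subrr.
Qed.

Definition L2_fun (u : L2) : T -> R[i] := L2fun_val (repr u).
Coercion L2_fun : L2 >-> Funclass.

Lemma L2_fun_si (u : L2) : square_integrable mu u.
Proof. exact: L2funP. Qed.
Hint Resolve L2_fun_si : core.

Let pi_ae (f : L2fun) : (\pi_L2 f : L2) = f %[ae mu in setT].
Proof. by apply/modP; rewrite reprK. Qed.

Lemma L2_eqP (u v : L2) : u = v %[ae mu in setT] <-> u = v.
Proof.
split=> [/modP/eqP|->]; first by rewrite !reprK.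
exact: ae_eq_refl.
Qed.

Lemma L2_funD (u v : L2) : (u + v : L2) = (fun x => u x + v x) %[ae mu in setT].
Proof.
have -> : u + v = \pi_L2 (repr u + repr v).
  by rewrite -{1}[u]reprK -{1}[v]reprK !piE.
exact: pi_ae.
Qed.

Let scale (a : R[i]) (u : L2) : L2 := \pi_L2 (a *: repr u).

Let pi_scale a (f : L2fun) : scale a (\pi_L2 f) = \pi_L2 (a *: f).
Proof.
by apply/eqP/modP; apply: filterS (pi_ae f) => x h xT; rewrite !valZ -h.
Qed.


Let scalerA a b (u : L2) : scale a (scale b u) = scale (a * b) u.
Proof. by rewrite {2}/scale pi_scale scalerA. Qed.

Let scale1r : left_id 1 scale.
Proof. by move=> u; rewrite /scale scale1r reprK. Qed.

Let scalerDr : right_distributive scale +%R.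
Proof.
move=> a u v.
have -> : u + v = \pi_L2 (repr u + repr v).
  by rewrite -{1}[u]reprK -{1}[v]reprK !piE.
by rewrite pi_scale scalerDr !piE.
Qed.

Let scalerDl u : {morph scale^~ u : a b / a + b}.
Proof. by move=> a b; rewrite /scale scalerDl !piE. Qed.

HB.instance Definition _ := GRing.Zmodule_isLmodule.Build R[i] L2
  scalerA scale1r scalerDr scalerDl.

Lemma L2_funZ a (u : L2) : (a *: u : L2) = (fun x => a * u x) %[ae mu in setT].
Proof. exact: pi_ae. Qed.

(* Conjugate-linear in the first argument. *)
Definition inner (u v : L2) : R[i] := cintegral mu setT (conj_mul u v).

Lemma inner_lin a (u v w : L2) :
  inner w (a *: u + v) = a * inner w u + inner w v.
Proof.
rewrite /inner -cintegral_lin//; [|exact: cintegrable_conj_mul..].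
apply: ae_eq_cintegral => //.
- by apply: cmeasurable_conj_mul; exact: (L2_fun_si _).1.
- rewrite (_ : (fun _ => _) = conj_mul w (fun x => a * u x + v x)).
    apply: cmeasurable_conj_mul; first exact: (L2_fun_si _).1.
    exact: (square_integrable_lin a (L2_fun_si u) (L2_fun_si v)).1.
  by apply/funext => x; rewrite /conj_mul mulrDr mulrCA.
apply: filterS2 (L2_funD (a *: u) v) (L2_funZ a u) => x h1 h2 xT.
by rewrite /conj_mul h1// h2// mulrDr mulrCA.
Qed.

Lemma inner_conj (u v : L2) : inner v u = (inner u v)^*%C.
Proof.
rewrite /inner -cintegral_conj//; last exact: cintegrable_conj_mul.
rewrite /cintegral; congr (_ +i* _); apply: eq_Rintegral => x _;
  by rewrite /conj_mul; case: (u x) (v x) => [a b] [c e] /=; ring.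
Qed.

Lemma inner_self (u : L2) : inner u u =
  (\int[mu]_x (Re (u x) ^+ 2 + Im (u x) ^+ 2))%:C.
Proof.
rewrite /inner /cintegral; congr (_ +i* _).
  apply: eq_Rintegral => x _.
  by rewrite /conj_mul; case: (u x) => [a b] /=; ring.
rewrite (@eq_Rintegral _ _ _ _ _ (cst 0)) ?Rintegral_cst// ?mul0r// => x _.
by rewrite /conj_mul; case: (u x) => [a b] /=; ring.
Qed.

Lemma inner_ge0 (u : L2) : 0 <= inner u u.
Proof.
rewrite inner_self ler0c fine_ge0//; apply: integral_ge0 => x _.
by rewrite lee_fin addr_ge0// sqr_ge0.
Qed.

Lemma inner_eq0 (u : L2) : inner u u = 0 -> u = 0.
Proof.
rewrite inner_self => -[h].
have /square_integrableP[[mr mi] iu] := L2_fun_si u.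
have /ae_eq_integral_abs : (\int[mu]_(x in setT)
    `|(Re (u x) ^+ 2 + Im (u x) ^+ 2)%:E| = 0)%E.
  under eq_integral do rewrite gee0_abs ?lee_fin ?addr_ge0 ?sqr_ge0//.
  rewrite -[LHS]fineK; first by rewrite [X in X%:E]h.
  exact: (integrable_fin_num measurableT iu).
move=> /(_ measurableT (measurable_int _ iu)) u0; apply/L2_eqP.
have h0 : (0 : L2) = cst 0 %[ae mu in setT].
  by have -> : (0 : L2) = \pi_L2 0 by [rewrite piE]; exact: pi_ae.
apply: filterS2 u0 h0 => x u0 -> // xT.
have [/eqP] := u0 xT; rewrite paddr_eq0 ?sqr_ge0// !sqrf_eq0 => /andP[/eqP + /eqP].
by case: (u x) => a b /= -> ->.
Qed.

Let rinner (u v : L2) : R := Re (inner u v).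

Let rinnerC u v : rinner u v = rinner v u.
Proof. by rewrite /rinner (inner_conj v u); case: (inner v u). Qed.

Let rinner_lin (t : R) (u v w : L2) :
  rinner w (t%:C *: u + v) = t * rinner w u + rinner w v.
Proof.
rewrite /rinner inner_lin; case: (inner w u) (inner w v) => [a b] [c e] /=.
by rewrite mul0r subr0.
Qed.

Let rinner_ge0 u : 0 <= rinner u u.
Proof. by have := inner_ge0 u; rewrite lecE => /andP[]. Qed.

Let rinner_quad t (u v : L2) : rinner (t%:C *: u + v) (t%:C *: u + v) =
  t ^+ 2 * rinner u u + 2 * t * rinner u v + rinner v v.
Proof.
rewrite rinner_lin (rinnerC _ u) (rinnerC _ v) !rinner_lin (rinnerC v u).
ring.
Qed.

Let rinner_CS u v : rinner u v ^+ 2 <= rinner u u * rinner v v.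
Proof.
have [u0|u0] := eqVneq (rinner u u) 0.
  have -> : u = 0.
    apply: inner_eq0; have := inner_ge0 u; rewrite lecE => /andP[/eqP i0 _].
    by move: u0 i0; rewrite /rinner; case: (inner u u) => a b /= -> ->.
  have h0 w : rinner w 0 = 0.
    by have := rinner_lin 0 0 0 w; rewrite scaler0 addr0 mul0r add0r => h;
      have := rinner_lin 1 0 0 w; rewrite scaler0 addr0 mul1r => h'; lra.
  by rewrite [rinner 0 v]rinnerC !h0 expr0n/= mul0r.
have p0 : 0 < rinner u u by rewrite lt_def u0 rinner_ge0.
have := rinner_ge0 ((- (rinner u v / rinner u u))%:C *: u + v).
rewrite rinner_quad; set p := rinner u u; set q := rinner v v; set r := rinner u v.
rewrite (_ : _ + _ + _ = q - r ^+ 2 / p); last by field.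
by rewrite subr_ge0 ler_pdivrMr// mulrC.
Qed.

Definition L2norm (u : L2) : R := Num.sqrt (Re (inner u u)).

Let L2normC (u : L2) : R[i] := (L2norm u)%:C.

Let L2norm_triangle (u v : L2) : L2normC (u + v) <= L2normC u + L2normC v.
Proof.
rewrite /L2normC -rmorphD lecR /L2norm -!/(rinner _ _).
have CS := rinner_CS u v.
rewrite -[leRHS]ger0_norm ?addr_ge0 ?sqrtr_ge0// -sqrtr_sqr.
rewrite ler_sqrt ?sqr_ge0// sqrrD !sqr_sqrtr ?rinner_ge0//.
have := rinner_quad 1 u v; rewrite (_ : 1%:C *: u = u); last exact: GRing.scale1r.
rewrite expr1n mul1r mulr1 => ->.
rewrite lerD2r lerD2l -[leRHS]mulr_natl ler_pM2l// -sqrtrM ?rinner_ge0//.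
by rewrite (le_trans (ler_norm _))// -sqrtr_sqr ler_sqrt// mulr_ge0.
Qed.

Let L2normZ a (u : L2) : L2normC (a *: u) = `|a| * L2normC u.
Proof.
rewrite /L2normC /L2norm.
have -> : inner (a *: u) (a *: u) = (Normc.normc a ^+ 2)%:C * inner u u.
  have h w : inner w (a *: u) = a * inner w u.
    have z : inner w 0 = 0.
      have := inner_lin 1 0 0 w; rewrite scaler0 addr0 mul1r => h.
      by apply: (@addrI _ (inner w 0)); rewrite -h addr0.
    by have := inner_lin a u 0 w; rewrite addr0 z addr0.
  rewrite h inner_conj h inner_self; case: a {h} => a b.
  rewrite [in RHS]/Normc.normc sqr_sqrtr ?addr_ge0 ?sqr_ge0//.
  by apply/eqP; rewrite eq_complex /=; apply/andP; split; apply/eqP => /=; ring.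
rewrite inner_self -rmorphM /= sqrtrM ?sqr_ge0// sqrtr_sqr.
rewrite ger0_norm; last by case: a => ? ? /=; exact: sqrtr_ge0.
by rewrite rmorphM; congr (_ * _).
Qed.

Let L2norm_eq0 (u : L2) : L2normC u = 0 -> u = 0.
Proof.
move=> -[] /eqP; rewrite sqrtr_eq0 => u0; apply: inner_eq0.
move: u0; rewrite inner_self /= => u0; congr (_%:C); apply/eqP.
by rewrite eq_le u0/= fine_ge0//; apply: integral_ge0 => x _;
  rewrite lee_fin addr_ge0// sqr_ge0.
Qed.

HB.instance Definition _ := Lmodule_isNormed.Build R[i] L2
  L2norm_triangle L2normZ L2norm_eq0.

Lemma L2_normE (u : L2) : `|u| = (L2norm u)%:C.
Proof. by []. Qed.
End L2_space.

Section operators.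
Context d (T : measurableType d) (R : realType).
Variable mu : {measure set T -> \bar R}.
Local Notation H := (L2 mu).

(* A possibly unbounded operator; only the values of app on dom are relevant. *)
Record operator := Operator { dom : set H; app :> H -> H }.

Definition everywhere (S : H -> H) : operator := Operator setT S.

Definition linear_operator (A : operator) : Prop :=
  dom A 0 /\
  forall (a : R[i]) (g h : H), dom A g -> dom A h ->
    dom A (a *: g + h) /\ A (a *: g + h) = a *: A g + A h.

Definition densely_defined (A : operator) : Prop := dense (dom A).

(* The graph of the adjoint of A is the graph of A. *)
Definition self_adjoint (A : operator) : Prop :=
  forall g w : H,
    (forall h, dom A h -> inner g (A h) = inner w h) <-> (dom A g /\ A g = w).

Definition bounded_operator (S : H -> H) : Prop :=
  linear S /\ exists M : R, forall h, `|S h| <= M%:C * `|h|.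

Definition resolvent_set (A : operator) : set R[i] :=
  [set z | exists S : H -> H,
    [/\ bounded_operator S,
        forall h, dom A (S h) /\ A (S h) - z *: S h = h &
        forall h, dom A h -> S (A h - z *: h) = h]].

(* The real points of the spectrum: all of it for a self-adjoint operator. *)
Definition spectrum (A : operator) : set R :=
  [set x | ~ resolvent_set A x%:C].

Definition hilbert_basis (e : nat -> H) : Prop :=
  (forall i j, inner (e i) (e j) = (i == j)%:R) /\
  dense [set h | exists N (a : nat -> R[i]), h = \sum_(k < N) a k *: e k].

Definition hilbert_schmidt (S : H -> H) : Prop :=
  bounded_operator S /\
  exists2 g : nat -> H, hilbert_basis g &
    cvgn (series (fun k => `|S (g k)| ^+ 2)).

(* Projection-valued measures on the Borel sets of R. *)
Record spectral_measure := SpectralMeasure {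
  sproj :> set R -> H -> H;
  sproj_linear : forall B, measurable B -> linear (sproj B);
  sproj_sym : forall B g h, measurable B -> inner g (sproj B h) = inner (sproj B g) h;
  sproj_set0 : forall h, sproj set0 h = 0;
  sproj_setT : forall h, sproj setT h = h;
  sproj_setI : forall B B' h, measurable B -> measurable B' ->
    sproj (B `&` B') h = sproj B (sproj B' h);
  sproj_bigcup : forall (F : (set R)^nat) h, (forall k, measurable (F k)) ->
    trivIset setT F ->
    series (fun k => sproj (F k) h) @ \oo --> sproj (\bigcup_k F k) h }.

Section vector_measure.
Variables (E : spectral_measure) (h : H).

(* B |-> <h|E(B)h>, written as ||E(B)h||^2 so that it is nonnegative on
   non-Borel sets too, as the measure interface demands. *)
Definition vector_measure (B : set R) : \bar R := (L2norm (E B h) ^+ 2)%:E.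

Let vector_measure0 : vector_measure set0 = 0%E.
Proof.
rewrite /vector_measure sproj_set0 (_ : L2norm 0 = 0) ?expr0n//.
by have := normr0 H => -[].
Qed.

Let vector_measure_ge0 B : (0 <= vector_measure B)%E.
Proof. by rewrite lee_fin sqr_ge0. Qed.

Let L2norm_sqr (g : H) : (L2norm g ^+ 2)%:C = inner g g.
Proof.
rewrite /L2norm sqr_sqrtr; last first.
  by have := inner_ge0 g; rewrite lecE => /andP[].
by rewrite inner_self.
Qed.

Let innerDr (u v w : H) : inner w (u + v) = inner w u + inner w v.
Proof. by have := inner_lin 1 u v w; rewrite scale1r mul1r. Qed.

Let innerDl (u v w : H) : inner (u + v) w = inner u w + inner v w.
Proof.
rewrite inner_conj innerDr (inner_conj u w) (inner_conj v w).
by case: (inner u w) (inner v w) => [? ?] [? ?] /=; congr (_ +i* _); rewrite ?opprD ?opprK.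
Qed.

Let inner0r (w : H) : inner w 0 = 0.
Proof. by apply: (@addrI _ (inner w 0)); rewrite -innerDr !addr0. Qed.

Let sproj_orth B B' : measurable B -> measurable B' -> B `&` B' = set0 ->
  inner (E B h) (E B' h) = 0.
Proof. by move=> mB mB' BB'; rewrite -sproj_sym// -sproj_setI// BB' sproj_set0. Qed.

Let vector_measure_sigma : semi_sigma_additive vector_measure.
Proof.
move=> F mF tF _.
have orth (n : nat) : inner (series (fun k => E (F k) h) n) (E (F n) h) = 0.
  rewrite /series/= big_nat.
  apply: (big_ind (fun g => inner g (E (F n) h) = 0)) => [|x y x0 y0|i /andP[_ ni]].
  - by rewrite inner_conj inner0r /= oppr0.
  - by rewrite innerDl x0 y0 addr0.
  - apply: sproj_orth => //; move/trivIsetP : tF => /(_ i n I I); apply.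
    by rewrite lt_eqF.
have sumE n : \sum_(0 <= i < n) L2norm (E (F i) h) ^+ 2 =
    L2norm (series (fun k => E (F k) h) n) ^+ 2.
  elim: n => [|n ih].
    rewrite /series/= !big_geq//; apply: (@complexI R).
    by rewrite L2norm_sqr inner0r.
  rewrite big_nat_recr//= ih; apply: (@complexI R); rewrite rmorphD/= !L2norm_sqr.
  have := orth n; set S := series _ n => SF.
  have -> : series (fun k => E (F k) h) n.+1 = S + E (F n) h.
    by rewrite seriesSr.
  by rewrite innerDl !innerDr SF (inner_conj S (E (F n) h)) SF /= oppr0 add0r addr0.
have Scvg : (fun n => L2norm (series (fun k => E (F k) h) n)) @ \oo -->
    L2norm (E (\bigcup_k F k) h).
  have /cvg_norm/cvgrPdist_lt := @sproj_bigcup E F h mF tF.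
  move=> Ecvg; apply/cvgrPdist_lt => eps eps0.
  have := Ecvg eps%:C; rewrite ltcR => /(_ eps0).
  apply: filterS => k; rewrite !L2_normE -rmorphB /=.
  by rewrite normc_def/= expr0n addr0 sqrtr_sqr ltcR.
rewrite /vector_measure; under eq_fun do rewrite sumEFin sumE.
by apply: cvg_EFin; [exact: nearW|exact: cvgM].
Qed.

HB.instance Definition _ := isMeasure.Build _ _ _ vector_measure
  vector_measure0 vector_measure_ge0 vector_measure_sigma.


End vector_measure.

(* A = \int x dE(x); the quadratic form determines A on its domain by
   polarization. *)
Definition is_spectral_measure_of (A : operator) (E : spectral_measure) : Prop :=
  forall h,
    (dom A h <-> (\int[vector_measure E h]_x (x ^+ 2)%:E < +oo)%E) /\
    (dom A h -> inner h (A h) =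
      cintegral (vector_measure E h) setT (fun x => x%:C)).

(* S = \int_{spectrum A} f dE. Only the restriction of f to the spectrum matters.
   The library integral is a supremum over Borel simple functions and makes sense
   for any integrand; for f bounded and universally measurable it is the integral
   with respect to the completion of the (finite) vector measure. *)
Definition is_functional_calculus (A : operator) (f : R -> R[i])
    (S : H -> H) : Prop :=
  exists E : spectral_measure,
    [/\ is_spectral_measure_of A E,
        bounded_operator S &
        forall h, inner h (S h) = cintegral (vector_measure E h) (spectrum A) f].

(* f(A): the unique such operator, provided by the spectral theorem. *)
Definition functional_calculus (A : operator) (f : R -> R[i]) : H -> H :=
  get (is_functional_calculus A f).

Definition is_weak_integral (D : set R) (F : R -> H) (v : H) : Prop :=
  forall g : H,
    cintegrable (@lebesgue_measure R) D (fun t => inner g (F t)) /\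
    inner g v = cintegral (@lebesgue_measure R) D (fun t => inner g (F t)).

Definition weakly_integrable (D : set R) (F : R -> H) : Prop :=
  exists v, is_weak_integral D F v.

Definition weak_integral (D : set R) (F : R -> H) : H :=
  get (is_weak_integral D F).

End operators.

Section universally_measurable.
Variable R : realType.

(* B is measurable for the completion of every finite Borel measure. *)
Definition universally_measurable_set (B : set R) : Prop :=
  forall nu : {finite_measure set R -> \bar R}, exists B1 B2 : set R,
    [/\ measurable B1, measurable B2, B1 `<=` B, B `<=` B2 &
        nu (B2 `\` B1) = 0%E].

Definition universally_measurable (D : set R) (f : R -> R[i]) : Prop :=
  forall U : set R[i], open U -> universally_measurable_set (D `&` f @^-1` U).

Definition time_interval (t : R) : set R :=
  if 0 <= t then `[0, t]%classic else `[t, 0]%classic.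

(* The entire extension of z |-> sin (s sqrt z) / sqrt z, by its power series. *)
Definition sin_sqrt_over_sqrt (s : R) (z : R[i]) : R[i] :=
  lim (series (fun k =>
    (-1) ^+ k * (s ^+ k.*2.+1 / (k.*2.+1)`!%:R)%:C * z ^+ k) @ \oo).

End universally_measurable.

Section bounded_domain.
Context (R : realType) (n : nat) (Omega : set 'rV[R]_n).

(* L2 (lebesgue_on oOmega) is L^2_C(Omega): the complement of Omega is null. *)
Definition lebesgue_on (oOmega : open Omega) : {measure set 'rV[R]_n -> \bar R} :=
  mrestr (lebesgue_rV R n) (open_measurable_rV oOmega).

Definition continuous_extension (oOmega : open Omega)
    (w : L2 (lebesgue_on oOmega)) (phi : 'rV[R]_n -> R[i]) : Prop :=
  {within closure Omega, continuous phi} /\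
  (w : 'rV[R]_n -> R[i]) = phi %[ae lebesgue_rV R n in Omega].

End bounded_domain.

(* Main.v *)
(** A self-adjoint operator A with a Hilbert basis of eigenvectors e_k is diagonal: every
    spectral measure E of A satisfies E(B) e_k = 1_B(lambda_k) e_k for Borel B, so the measure
    <h|E(.)h> is the discrete one with mass |<e_k|h>|^2 at lambda_k, and f(A) is the diagonal
    operator with entries f(lambda_k). Conversely the completeness of L^2 makes diagonal
    operators with bounded entries available. By Parseval, f(A) is Hilbert-Schmidt exactly
    when f(lambda_k) is square summable; then f(lambda_k) <e_k|u> is absolutely summable by
    Cauchy-Schwarz, and since the e_k are uniformly bounded, the expansion of f(A)u converges
    uniformly to a continuous function. For the wave integrals the coefficients are
    diagonalized in the same way, and the Lipschitz estimate
    |S_s(c - f(lambda_k)) - S_s(c)| <= C |f(lambda_k)| for the entire function S_s makes the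
    coefficients of v - v_c absolutely summable. *)

Require Import Defs.
From mathcomp Require Import all_boot all_order all_algebra.
From mathcomp Require Import complex ring lra.
From mathcomp Require Import all_classical all_reals all_analysis.
From mathcomp Require Import measurable_realfun.
Import Order.TTheory GRing.Theory Num.Theory.
Import numFieldNormedType.Exports HBNNSimple.
Local Open Scope classical_set_scope.
Local Open Scope ring_scope.
Local Open Scope complex_scope.
Set Implicit Arguments.
Unset Strict Implicit.
Unset Printing Implicit Defensive.

Local Notation Re := (@complex.Re _).
Local Notation Im := (@complex.Im _).
Local Notation normc := (@Normc.normc _).

(** * Complex numbers *)

(** [functional_calculus] picks some operator whose quadratic form is an integral against some
    spectral measure of [A], so two things must be shown: a spectral measure of [A] exists, and
    every one of them yields the same diagonal operator. Uniqueness is the delicate half, because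
    [is_spectral_measure_of] offers only the second moments that describe the domain and the
    quadratic form of [A], with no commutation between [A] and the projections. The action on
    eigenvectors is recovered by cutting [e k] down to a half-line that misses [lam k]: there the
    centred first moment vanishes although its integrand has a strict sign. Once the scalar measures
    are known to be carried by the countable set of eigenvalues, on which every function is
    measurable, the integral of [f] becomes a series. The operator [c - f(A)] is again self-adjoint
    with the same eigenvectors, so the same diagonalization applies to the wave kernels. Library
    norms on [R[i]] and [L2] are [R[i]]-valued; the estimates use the real [normc] and [L2norm], and
    [cvg_normP] carries limits across. *)

Lemma cvg_eqfun (T : Type) (U : topologicalType) (F : set_system T) (u v : T -> U) (l : U) :
  u =1 v -> u @ F --> l -> v @ F --> l.
Proof. by move=> /funext ->. Qed.

Section complex_norm.
Context {R : realType}.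
Implicit Types (z w : R[i]) (x y : R).

Lemma normC z : `|z| = (normc z)%:C.
Proof. by []. Qed.

Lemma normc_ge0 z : 0 <= normc z.
Proof. by case: z => a b; exact: sqrtr_ge0. Qed.

Lemma normcD z w : normc (z + w) <= normc z + normc w.
Proof. exact: le_normcD. Qed.

Lemma normcNl z : normc (- z) = normc z.
Proof. exact: normcN. Qed.

Lemma normcBC z w : normc (z - w) = normc (w - z).
Proof. by rewrite -normcNl opprB. Qed.

Lemma normc_sqr z : normc z ^+ 2 = Re z ^+ 2 + Im z ^+ 2.
Proof. by case: z => a b /=; rewrite sqr_sqrtr// addr_ge0// sqr_ge0. Qed.

Lemma normc_real x : normc x%:C = `|x|.
Proof. by rewrite /= expr0n addr0 sqrtr_sqr. Qed.

Lemma normc_conj z : normc z^*%C = normc z.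
Proof. by case: z => a b /=; rewrite sqrrN. Qed.

Lemma conj_mul_normc z : z^*%C * z = (normc z ^+ 2)%:C.
Proof.
rewrite normc_sqr; case: z => a b.
by apply/eqP; rewrite eq_complex /=; apply/andP; split; apply/eqP; ring.
Qed.

Lemma Re_le_normc z : `|Re z| <= normc z.
Proof.
by case: z => a b /=; rewrite -sqrtr_sqr ler_sqrt ?addr_ge0 ?sqr_ge0// lerDl sqr_ge0.
Qed.

Lemma Im_le_normc z : `|Im z| <= normc z.
Proof.
by case: z => a b /=; rewrite -sqrtr_sqr ler_sqrt ?addr_ge0 ?sqr_ge0// lerDr sqr_ge0.
Qed.

Lemma normc_le_ReIm z : normc z <= `|Re z| + `|Im z|.
Proof.
rewrite -ler_sqr ?nnegrE ?addr_ge0 ?normc_ge0// normc_sqr sqrrD !real_normK ?num_real//.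
by rewrite lerD2r lerDl mulrn_wge0// mulr_ge0.
Qed.

Lemma normcX z k : normc (z ^+ k) = normc z ^+ k.
Proof. by elim: k => [|k ih]; rewrite ?expr0 ?Normc.normc1// !exprS Normc.normcM ih. Qed.

Lemma normc_sum (I : Type) (r : seq I) (P : pred I) (F : I -> R[i]) :
  normc (\sum_(i <- r | P i) F i) <= \sum_(i <- r | P i) normc (F i).
Proof.
elim/big_ind2: _ => [|z x w y zx wy|//]; first by rewrite Normc.normc0.
by rewrite (le_trans (normcD _ _))// lerD.
Qed.

(** The bridge from convergence in a complex normed space, where tolerances are elements of [R[i]],
    to a real limit. It is instantiated with [normc] on [R[i]] and with [L2norm]. *)
Lemma cvg_normP (V : normedModType R[i]) (N : V -> R) (T : Type)
    (F : set_system T) {FF : Filter F} (u : T -> V) (l : V) :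
    (forall v, `|v| = (N v)%:C) ->
  u @ F --> l <-> N (u x - l) @[x --> F] --> (0 : R).
Proof.
move=> NE; have N0 v : 0 <= N v by have := normr_ge0 v; rewrite NE ler0c.
have NC v : N (- v) = N v by have := normrN v; rewrite !NE => -[].
split=> [/cvgrPdist_lt h|/cvgrPdist_lt h]; apply/cvgrPdist_lt => eps eps0.
  have := h eps%:C; rewrite ltcR => /(_ eps0); apply: filterS => x.
  by rewrite NE ltcR sub0r normrN ger0_norm// -NC opprB.
(* Positivity in [R[i]] means zero imaginary part and positive real part, so [Re eps] serves as the
   real tolerance. *)
have e0 := eps0; move: eps0; rewrite ltcE /= => /andP[/eqP Ie Re0].
have := h _ Re0; apply: filterS => x; rewrite sub0r normrN ger0_norm// => hx.
by rewrite NE ltcE /= Ie eqxx -NC opprB.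
Qed.

Lemma cvgCP (T : Type) (F : set_system T) {FF : Filter F} (u : T -> R[i]) (l : R[i]) :
  u @ F --> l <-> normc (u x - l) @[x --> F] --> (0 : R).
Proof. exact: cvg_normP. Qed.

Lemma cvg_Re (T : Type) (F : set_system T) {FF : Filter F} (u : T -> R[i]) (l : R[i]) :
  u @ F --> l -> Re (u x) @[x --> F] --> Re l.
Proof.
move=> /cvgCP/cvgrPdist_lt h; apply/cvgrPdist_lt => eps /h {h}; apply: filterS => x.
rewrite sub0r normrN ger0_norm ?normc_ge0// distrC; apply: le_lt_trans.
by apply: le_trans (Re_le_normc _); case: (u x) l => [? ?] [? ?].
Qed.

Lemma cvg_Im (T : Type) (F : set_system T) {FF : Filter F} (u : T -> R[i]) (l : R[i]) :
  u @ F --> l -> Im (u x) @[x --> F] --> Im l.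
Proof.
move=> /cvgCP/cvgrPdist_lt h; apply/cvgrPdist_lt => eps /h {h}; apply: filterS => x.
rewrite sub0r normrN ger0_norm ?normc_ge0// distrC; apply: le_lt_trans.
by apply: le_trans (Im_le_normc _); case: (u x) l => [? ?] [? ?].
Qed.

Lemma cvg_ReIm (T : Type) (F : set_system T) {FF : Filter F} (u : T -> R[i]) (l : R[i]) :
  Re (u x) @[x --> F] --> Re l -> Im (u x) @[x --> F] --> Im l -> u @ F --> l.
Proof.
move=> hr hi; apply/cvgCP.
have h : `|Re (u x) - Re l| + `|Im (u x) - Im l| @[x --> F] --> (0 : R).
  rewrite -(addr0 (0 : R)); by apply: cvgD; apply/norm_cvg0P/subr_cvg0.
apply: (squeeze_cvgr _ (cvg_cst 0) h); apply: nearW => x; rewrite normc_ge0/=.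
by apply: le_trans (normc_le_ReIm _) _; case: (u x) l {hr hi h} => [? ?] [? ?].
Qed.

Lemma cvg_normc (T : Type) (F : set_system T) {FF : Filter F} (u : T -> R[i]) (l : R[i]) :
  u @ F --> l -> normc (u x) @[x --> F] --> normc l.
Proof.
move=> /cvgCP/cvgrPdist_le h; apply/cvgrPdist_le => eps /h {h}; apply: filterS => x.
rewrite sub0r normrN ger0_norm ?normc_ge0//; apply: le_trans.
have h (a b : R[i]) : normc a - normc b <= normc (a - b).
  by rewrite lerBlDr (le_trans _ (normcD _ _))// subrK.
by rewrite ler_norml -lerNl opprB h/= normcBC h.
Qed.

Lemma cvg_sqr (T : Type) (F : set_system T) {FF : Filter F} (u : T -> R) (l : R) :
  u @ F --> l -> u x ^+ 2 @[x --> F] --> l ^+ 2.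
Proof. by move=> ul; under eq_fun do rewrite expr2; rewrite expr2; exact: cvgM. Qed.

Lemma cvgn_EFin (u : nat -> R) (l : R) :
  u @ \oo --> l -> (u n)%:E @[n --> \oo] --> l%:E.
Proof. by move=> h; apply: cvg_EFin; [exact: nearW|exact: h]. Qed.

Lemma series_real (a : nat -> R) n :
  series (fun k => (a k)%:C) n = (series a n)%:C.
Proof. by rewrite /series/= rmorph_sum. Qed.

Lemma cvgn_real (a : nat -> R) : cvgn (fun n => (a n)%:C) <-> cvgn a.
Proof.
split=> [/cvg_Re h|h]; first by apply/cvg_ex; exists (Re (lim ((a n)%:C @[n --> \oo]))).
apply/cvg_ex; exists (limn a)%:C; apply: cvg_ReIm => //=; exact: cvg_cst.
Qed.

Lemma series_le_cvg_bound (a : nat -> R) M : (forall k, 0 <= a k) ->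
  (forall n, \sum_(0 <= k < n) a k <= M) -> cvgn (series a).
Proof.
move=> a0 aM; apply: nondecreasing_is_cvgn.
  by apply/nondecreasing_seqP => n; rewrite /series/= big_nat_recr//= lerDl.
by exists M => _ [n _ <-]; exact: aM.
Qed.

Lemma series_nneg_le_lim (a : nat -> R) n : (forall k, 0 <= a k) ->
  cvgn (series a) -> \sum_(0 <= k < n) a k <= limn (series a).
Proof.
move=> a0 ca; apply: nondecreasing_cvgn_le => //.
by apply/nondecreasing_seqP => m; rewrite /series/= big_nat_recr//= lerDl.
Qed.

End complex_norm.

Arguments inner : simpl never.
Arguments Normc.normc : simpl never.
Arguments conjc : simpl never.

(** * Hilbert space geometry of L^2 *)

Section inner_theory.
Context d (T : measurableType d) (R : realType) (mu : {measure set T -> \bar R}).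
Local Notation H := (L2 mu).
Implicit Types (u v w g h : H) (a : R[i]).

Lemma innerDr u v w : inner w (u + v) = inner w u + inner w v.
Proof. by have := inner_lin 1 u v w; rewrite scale1r mul1r. Qed.

Lemma inner0r w : inner w 0 = 0.
Proof. by apply: (@addrI _ (inner w 0)); rewrite -innerDr !addr0. Qed.

Lemma innerZr a u w : inner w (a *: u) = a * inner w u.
Proof. by have := inner_lin a u 0 w; rewrite inner0r !addr0. Qed.

Lemma innerNr u w : inner w (- u) = - inner w u.
Proof. by rewrite -scaleN1r innerZr mulN1r. Qed.

Lemma innerBr u v w : inner w (u - v) = inner w u - inner w v.
Proof. by rewrite innerDr innerNr. Qed.

Lemma innerDl u v w : inner (u + v) w = inner u w + inner v w.
Proof. by rewrite inner_conj innerDr (inner_conj w u) (inner_conj w v) rmorphD. Qed.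

Lemma inner0l w : inner 0 w = 0.
Proof. by rewrite inner_conj inner0r rmorph0. Qed.

Lemma innerZl a u w : inner (a *: u) w = a^*%C * inner u w.
Proof. by rewrite inner_conj innerZr (inner_conj w u) rmorphM. Qed.

Lemma innerNl u w : inner (- u) w = - inner u w.
Proof. by rewrite inner_conj innerNr (inner_conj w u) rmorphN. Qed.

Lemma innerBl u v w : inner (u - v) w = inner u w - inner v w.
Proof. by rewrite innerDl innerNl. Qed.

Lemma inner_sumr (I : Type) (r : seq I) (P : pred I) (F : I -> H) w :
  inner w (\sum_(i <- r | P i) F i) = \sum_(i <- r | P i) inner w (F i).
Proof. exact: (big_morph _ (fun u v => innerDr u v w) (inner0r w)). Qed.

Lemma inner_suml (I : Type) (r : seq I) (P : pred I) (F : I -> H) w :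
  inner (\sum_(i <- r | P i) F i) w = \sum_(i <- r | P i) inner (F i) w.
Proof. exact: (big_morph _ (fun u v => innerDl u v w) (inner0l w)). Qed.

Lemma L2norm_ge0 u : 0 <= L2norm u.
Proof. exact: sqrtr_ge0. Qed.

Lemma inner_L2norm u : inner u u = (L2norm u ^+ 2)%:C.
Proof.
rewrite /L2norm sqr_sqrtr; last by have := inner_ge0 u; rewrite lecE => /andP[].
by rewrite inner_self.
Qed.

Lemma L2norm0 : L2norm (0 : H) = 0.
Proof. by have := normr0 H => -[]. Qed.

Lemma L2norm_eq0 u : L2norm u = 0 -> u = 0.
Proof. by move=> h; apply: inner_eq0; rewrite inner_L2norm h expr0n. Qed.

Lemma L2normD u v : L2norm (u + v) <= L2norm u + L2norm v.
Proof. by have := ler_normD u v; rewrite !L2_normE -rmorphD lecR. Qed.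

Lemma L2normZ a u : L2norm (a *: u) = normc a * L2norm u.
Proof. by apply: complexI; rewrite -L2_normE normrZ rmorphM. Qed.

Lemma L2normN u : L2norm (- u) = L2norm u.
Proof. by apply: complexI; rewrite -!L2_normE normrN. Qed.

Lemma L2norm_distC u v : L2norm (u - v) = L2norm (v - u).
Proof. by rewrite -L2normN opprB. Qed.

Lemma L2norm_sqrD u v :
  L2norm (u + v) ^+ 2 = L2norm u ^+ 2 + 2 * Re (inner u v) + L2norm v ^+ 2.
Proof.
have := inner_L2norm (u + v).
rewrite innerDl !innerDr !inner_L2norm (inner_conj u v).
case: (inner u v) => p q /= [<- _]; ring.
Qed.

Lemma L2norm_pythagoras u v : inner u v = 0 ->
  L2norm (u + v) ^+ 2 = L2norm u ^+ 2 + L2norm v ^+ 2.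
Proof. by move=> uv0; rewrite L2norm_sqrD uv0 /= mulr0 addr0. Qed.

Lemma cauchy_schwarz u v : normc (inner u v) <= L2norm u * L2norm v.
Proof.
(* For the real part alone, Cauchy-Schwarz is the squared triangle inequality. *)
have reCS (x y : H) : Re (inner x y) <= L2norm x * L2norm y.
  have := L2normD x y; rewrite -ler_sqr ?nnegrE ?addr_ge0 ?L2norm_ge0//.
  by rewrite L2norm_sqrD; lra.
have [->|a0] := eqVneq (inner u v) 0.
  by rewrite Normc.normc0 mulr_ge0 ?L2norm_ge0.
have n0 : normc (inner u v) != 0.
  by apply: contraNneq a0 => /Normc.eq0_normc ->.
(* The unimodular factor that rotates [inner u v] onto its modulus, which reduces the claim to the
   real part. *)
pose r := (inner u v)^*%C * (normc (inner u v))^-1%:C.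
have := reCS u (r *: v); rewrite innerZr L2normZ /r mulrAC conj_mul_normc.
rewrite Normc.normcM normc_conj normc_real ger0_norm ?invr_ge0 ?normc_ge0//.
by rewrite mulfV// mul1r -rmorphM /= expr2 mulfK.
Qed.

Lemma L2cvgP (U : Type) (F : set_system U) {FF : Filter F} (x : U -> H) l :
  x @ F --> l <-> L2norm (x t - l) @[t --> F] --> (0 : R).
Proof. exact: cvg_normP. Qed.

Lemma cvg_innerr (U : Type) (F : set_system U) {FF : Filter F} (x : U -> H) l g :
  x @ F --> l -> inner g (x t) @[t --> F] --> inner g l.
Proof.
move=> /L2cvgP h; apply/cvgCP.
have h' : L2norm g * L2norm (x t - l) @[t --> F] --> (0 : R).
  by rewrite -(mulr0 (L2norm g)); apply: cvgM => //; exact: cvg_cst.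
apply: (squeeze_cvgr _ (cvg_cst 0) h'); apply: nearW => t.
by rewrite normc_ge0 -innerBr cauchy_schwarz.
Qed.

Lemma cvg_L2norm (U : Type) (F : set_system U) {FF : Filter F} (x : U -> H) l :
  x @ F --> l -> L2norm (x t) @[t --> F] --> L2norm l.
Proof.
move=> /L2cvgP/cvgrPdist_le h; apply/cvgrPdist_le => eps /h {h}; apply: filterS => t.
rewrite sub0r normrN ger0_norm ?L2norm_ge0//; apply: le_trans.
have h (a b : H) : L2norm a - L2norm b <= L2norm (a - b).
  by rewrite lerBlDr (le_trans _ (L2normD _ _))// subrK.
by rewrite ler_norml -lerNl opprB h/= L2norm_distC h.
Qed.

Lemma inner_ext u v : (forall g, inner g u = inner g v) -> u = v.
Proof.
move=> h; apply/eqP; rewrite -subr_eq0; apply/eqP/inner_eq0.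
by rewrite innerBr h subrr.
Qed.

Section orthonormal.
Variable e : nat -> H.
Hypothesis e_ortho : forall i j, inner (e i) (e j) = (i == j)%:R.

Lemma inner_basis_sum (a : nat -> R[i]) j n :
  inner (e j) (\sum_(0 <= k < n) a k *: e k) = (j < n)%N%:R * a j.
Proof.
elim: n => [|n ih]; first by rewrite big_geq// inner0r mul0r.
rewrite big_nat_recr//= innerDr ih innerZr e_ortho.
by case: (ltngtP j n) => [jn|nj|->]; rewrite ?(mulr0, addr0, mul0r, add0r, mulr1, mul1r)//=
  ltnS ?(ltnW jn) ?leqnn ?mul1r// leqNgt nj mul0r.
Qed.

Lemma L2norm_basis_sum (a : nat -> R[i]) m n :
  L2norm (\sum_(m <= k < n) a k *: e k) ^+ 2 = \sum_(m <= k < n) normc (a k) ^+ 2.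
Proof.
have [nm|/ltnW mn] := leqP n m; first by rewrite !big_geq// L2norm0 expr0n.
elim: n mn => [|n ih]; first by rewrite leqn0 => /eqP ->; rewrite !big_geq// L2norm0 expr0n.
rewrite leq_eqVlt => /predU1P[->|mn]; first by rewrite !big_geq// L2norm0 expr0n.
rewrite !big_nat_recr//= -ih// L2norm_pythagoras.
  congr (_ + _); apply: complexI; rewrite -inner_L2norm innerZl innerZr e_ortho eqxx.
  by rewrite mulr1 conj_mul_normc.
rewrite inner_suml big_nat big1// => k /andP[_ kn].
by rewrite innerZl innerZr e_ortho lt_eqF// !mulr0.
Qed.

(** The Fourier remainder of [h] is orthogonal to [e 0, ..., e (n-1)], so Pythagoras applies. Taking
    [a = 0] gives Bessel; comparing with a dense combination gives the basis expansion. *)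
Lemma best_approximation (a : nat -> R[i]) n h :
  L2norm (h - \sum_(0 <= k < n) a k *: e k) ^+ 2 =
  L2norm (h - \sum_(0 <= k < n) inner (e k) h *: e k) ^+ 2 +
  \sum_(0 <= k < n) normc (inner (e k) h - a k) ^+ 2.
Proof.
rewrite -L2norm_basis_sum -L2norm_pythagoras.
  congr (L2norm _ ^+ 2); under [X in _ = _ + X]eq_bigr do rewrite scalerBl.
  by rewrite sumrB addrA subrK.
rewrite inner_sumr big_nat big1// => k /andP[_ kn].
rewrite innerZr (inner_conj (e k)) innerBr inner_basis_sum kn mul1r subrr.
by rewrite rmorph0 mulr0.
Qed.

Lemma bessel h n : \sum_(0 <= k < n) normc (inner (e k) h) ^+ 2 <= L2norm h ^+ 2.
Proof.
have := best_approximation (fun=> 0) n h.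
rewrite big1 ?subr0 => [->|k _]; last by rewrite scale0r.
by under [X in _ <= _ + X]eq_bigr do rewrite subr0; rewrite lerDr sqr_ge0.
Qed.

Lemma normc_inner_basis h k : normc (inner (e k) h) <= L2norm h.
Proof.
rewrite (le_trans (cauchy_schwarz _ _))// -[leRHS]mul1r ler_wpM2r ?L2norm_ge0//.
by rewrite /L2norm e_ortho eqxx /= sqrtr1.
Qed.

End orthonormal.

Section basis.
Variable e : nat -> H.
Hypothesis he : hilbert_basis e.
Let e_ortho : forall i j, inner (e i) (e j) = (i == j)%:R := he.1.

Lemma basis_expansion h : series (fun k => inner (e k) h *: e k) @ \oo --> h.
Proof.
apply/L2cvgP/cvgrPdist_lt => eps eps0.
have [|g [/= hg [N [a ga]]]] := he.2 (ball h eps%:C) _ (ball_open _ _).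
  by exists h; apply: ballxx; rewrite ltcR.
near=> n.
rewrite sub0r normrN ger0_norm ?L2norm_ge0// L2norm_distC.
apply: (@le_lt_trans _ _ (L2norm (h - g))); last first.
  by move: hg; rewrite -ball_normE /= L2_normE ltcR.
rewrite -ler_sqr ?nnegrE ?L2norm_ge0//.
(* Padding by zeros turns the combination [g] of length [N] into one of length [n >= N], which the
   Fourier sum of length [n] cannot do worse than. *)
pose b k := if (k < N)%N then a k else 0.
have -> : g = \sum_(0 <= k < n) b k *: e k.
  rewrite ga (big_cat_nat _ (n := N))//=; last by near: n; exists N.
  rewrite [X in _ + X]big_nat [X in _ + X]big1 ?addr0 => [|k /andP[Nk _]].
    by rewrite big_mkord; apply: eq_bigr => i _; rewrite /b ltn_ord.
  by rewrite /b ltnNge Nk scale0r.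
by rewrite (best_approximation e_ortho b n h) lerDl sumr_ge0// => k _; rewrite sqr_ge0.
Unshelve. all: by end_near. Qed.

Lemma basis_ext u v : (forall k, inner (e k) u = inner (e k) v) -> u = v.
Proof.
move=> uv; have := @basis_expansion u.
under eq_fun do rewrite uv.
by move=> /(cvg_unique (@norm_hausdorff _ H)) /(_ (@basis_expansion v)).
Qed.

Lemma parseval g h :
  series (fun k => (inner (e k) g)^*%C * inner (e k) h) @ \oo --> inner g h.
Proof.
apply: (cvg_eqfun _ (cvg_innerr (g := g) (@basis_expansion h))) => n.
rewrite /series/= inner_sumr; apply: eq_bigr => k _.
by rewrite innerZr mulrC -inner_conj.
Qed.

Lemma parseval_norm h :
  series (fun k => normc (inner (e k) h) ^+ 2) @ \oo --> L2norm h ^+ 2.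
Proof.
have -> : L2norm h ^+ 2 = Re (inner h h) by rewrite inner_L2norm.
apply: (cvg_eqfun _ (cvg_Re (@parseval h h))) => n.
by rewrite /series /=; under eq_bigr do rewrite conj_mul_normc; rewrite -rmorph_sum.
Qed.

End basis.
End inner_theory.

(** * Completeness of L^2 *)

Section completeness.
Context d (T : measurableType d) (R : realType) (mu : {measure set T -> \bar R}).
Local Notation H := (L2 mu).
Implicit Types (u v w : H).

Lemma L2_pi_ae (f : L2fun mu) : L2_fun (\pi_(L2 mu) f)%qT = f %[ae mu in setT].
Proof.
have /eqP := reprK (\pi_(L2 mu) f)%qT.
rewrite -Quotient.idealrBE inE /=.
by apply: filterS => x /(_ I) h _; apply/eqP; rewrite -subr_eq0; apply/eqP.
Qed.

Lemma L2_of_fun (f : T -> R[i]) : square_integrable mu f ->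
  exists w, L2_fun w = f %[ae mu in setT].
Proof.
by move=> sf; exists (\pi_(L2 mu) (MkL2fun (mem_set sf)))%qT; exact: L2_pi_ae.
Qed.

Lemma L2_funB u v : (u - v : H) = (fun x => u x - v x) %[ae mu in setT].
Proof.
rewrite -scaleN1r; apply: filterS2 (L2_funD u (-1 *: v)) (L2_funZ (-1) v).
by move=> x h1 h2 xT; rewrite h1// h2// mulN1r.
Qed.

Lemma measurable_normc_sqr (f : T -> R[i]) : cmeasurable f ->
  measurable_fun setT (fun x => (normc (f x) ^+ 2)%:E).
Proof.
move=> [mr mi]; apply/measurable_EFinP.
under eq_fun do rewrite normc_sqr.
by apply: measurable_funD; exact: measurable_funX.
Qed.

Lemma cmeasurableB (f g : T -> R[i]) : cmeasurable f -> cmeasurable g ->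
  cmeasurable (fun x => f x - g x).
Proof.
move=> [fr fi] [gr gi]; split.
  rewrite (_ : (fun _ => _) = (fun x => Re (f x) - Re (g x))).
    exact: measurable_funB.
  by apply/funext => x; case: (f x) (g x) => [? ?] [? ?].
rewrite (_ : (fun _ => _) = (fun x => Im (f x) - Im (g x))).
  exact: measurable_funB.
by apply/funext => x; case: (f x) (g x) => [? ?] [? ?].
Qed.

Lemma cmeasurable_L2 u : cmeasurable u.
Proof. exact: (L2_fun_si u).1. Qed.

Lemma integral_normc_sqr u : (\int[mu]_x (normc (u x) ^+ 2)%:E)%E = (L2norm u ^+ 2)%:E.
Proof.
have [mu1 iu] := (square_integrableP _ _).1 (L2_fun_si u).
under eq_integral do rewrite normc_sqr.
rewrite -[LHS]fineK; last exact: (integrable_fin_num measurableT iu).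
by congr (_%:E); apply: complexI; rewrite -inner_self inner_L2norm.
Qed.

Lemma integral_normcB_sqr u v :
  (\int[mu]_x (normc (u x - v x) ^+ 2)%:E)%E = (L2norm (u - v) ^+ 2)%:E.
Proof.
rewrite -integral_normc_sqr; apply: ae_eq_integral => //.
- by apply: measurable_normc_sqr; apply: cmeasurableB; exact: cmeasurable_L2.
- by apply: measurable_normc_sqr; exact: cmeasurable_L2.
- by apply: filterS (L2_funB u v) => x h xT; rewrite h.
Qed.

(** The lower limit is measurable in any case, so no measurable pointwise limit has to be supplied;
    a.e. convergence is used afterwards, to identify the lower limit. *)
Lemma fatou_L2 (f : nat -> H) v (eps : R) N :
  (forall i, (N <= i)%N -> L2norm (f i - v) <= eps) ->
  (\int[mu]_x limn_einf (fun i => (normc (f i x - v x) ^+ 2)%:E) <= (eps ^+ 2)%:E)%E.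
Proof.
move=> fv.
have mf i : measurable_fun setT (fun x => (normc (f i x - v x) ^+ 2)%:E).
  by apply: measurable_normc_sqr; apply: cmeasurableB; exact: cmeasurable_L2.
apply: (le_trans (fatou mu measurableT mf _)).
  by move=> n x _; rewrite lee_fin sqr_ge0.
under eq_fun do rewrite integral_normcB_sqr.
(* The infimum of the tail from [n] is at most the term of index [maxn n N], which lies both in that
   tail and beyond [N]. *)
rewrite limn_einf_lim; apply: lime_le; first exact: is_cvg_einfs.
apply: nearW => n; apply: le_trans (_ : (L2norm (f (maxn n N) - v) ^+ 2)%:E <= _)%E.
  by apply: ereal_inf_lbound; exists (maxn n N) => //=; exact: leq_maxl.
by rewrite lee_fin ler_sqr ?nnegrE ?L2norm_ge0 ?(le_trans (L2norm_ge0 _) (fv N _))// fv// leq_maxr.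
Qed.

Lemma measurable_limn_einf (f : nat -> T -> \bar R) :
  (forall n, measurable_fun setT (f n)) ->
  measurable_fun setT (fun x => limn_einf (f ^~ x)).
Proof.
move=> mf; under eq_fun do rewrite /limn_einf.
apply: measurableT_comp => //; apply: measurable_fun_limn_esup => n.
by apply: measurableT_comp.
Qed.

(** By Fatou the lower limit of [|f i - w|^2] has integral 0 and vanishes a.e.; where [f i x] tends
    to [phi x] it equals [|phi x - w x|^2]. The argument integrates the lower limit [g], not
    [phi - w], as [phi] is an arbitrary function. *)
Lemma cvg_ae_unique (f : nat -> H) w (phi : T -> R[i]) : f @ \oo --> w ->
  {ae mu, forall x, f ^~ x @ \oo --> phi x} -> L2_fun w = phi %[ae mu in setT].
Proof.
move=> /L2cvgP/cvgrPdist_le fw fphi.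
pose g x := limn_einf (fun i => (normc (f i x - w x) ^+ 2)%:E : \bar R).
have g0 x : (0 <= g x)%E.
  rewrite /g limn_einf_lim; apply: lime_ge; first exact: is_cvg_einfs.
  by apply: nearW => n; apply: le_ereal_inf_tmp => _ [m _ <-]; rewrite lee_fin sqr_ge0.
have mg : measurable_fun setT g.
  apply: measurable_limn_einf => n.
  by apply: measurable_normc_sqr; apply: cmeasurableB; exact: cmeasurable_L2.
have ig : (\int[mu]_x `|g x| = 0)%E.
  under eq_integral do rewrite gee0_abs//.
  apply/eqP; rewrite eq_le integral_ge0// andbT.
  apply/lee_addgt0Pr => eps eps0; rewrite add0e.
  have [|N _ hN] := fw (Num.sqrt eps); first by rewrite sqrtr_gt0.
  rewrite -[eps](sqr_sqrtr (ltW eps0)).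
  apply: (@fatou_L2 _ _ _ N) => i /hN.
  by rewrite sub0r normrN ger0_norm ?L2norm_ge0.
have /ae_eq_integral_abs := ig => /(_ measurableT mg) gae.
apply: filterS2 gae fphi => x /(_ I) gx fx _.
have h : normc (f i x - w x) ^+ 2 @[i --> \oo] --> normc (phi x - w x) ^+ 2.
  by apply: cvg_sqr; apply: cvg_normc; apply: cvgB fx _; exact: cvg_cst.
have := (cvg_limn_einf_sup (cvgn_EFin h)).1.
rewrite -/(g x) gx => -[] /esym/eqP; rewrite sqrf_eq0 => /eqP/Normc.eq0_normc/eqP.
by rewrite subr_eq0 => /eqP ->.
Qed.

Lemma geometric_half_cvg (C : R) : cvgn (series (fun k => C * 2^-1 ^+ k)).
Proof. by apply: is_cvg_geometric_series; rewrite ger0_norm// invf_lt1// ltr1n. Qed.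

Lemma cvg_of_geometric (a : nat -> R) (C : R) :
  (forall j, `|a j.+1 - a j| <= C * 2^-1 ^+ j) -> cvgn a.
Proof.
move=> aC; rewrite (_ : a = fun n => a 0%N + series (fun j => a j.+1 - a j) n).
  apply: is_cvgD; first exact: is_cvg_cst.
  apply: normed_cvg; apply: (@series_le_cvg _ (fun j => `|a j.+1 - a j|) _ _ _ aC) => //.
    by move=> n; exact: le_trans (aC n).
  exact: geometric_half_cvg.
apply/funext => n; rewrite /series/=; elim: n => [|n ih]; first by rewrite big_geq// addr0.
by rewrite big_nat_recr//= addrA -ih addrC subrK.
Qed.

(** Riesz-Fischer: a fast subsequence converges a.e., Fatou shows that the limit is square
    integrable, and the Cauchy property carries the convergence back to the full sequence. *)
Lemma L2_complete (u : nat -> H) :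
  (forall eps : R, 0 < eps ->
     exists N, forall m n, (N <= m)%N -> (N <= n)%N -> L2norm (u m - u n) <= eps) ->
  exists w, u @ \oo --> w.
Proof.
move=> ucauchy.
have /choice[N hN] (j : nat) : exists N, forall m n, (N <= m)%N -> (N <= n)%N ->
    L2norm (u m - u n) <= 4^-1 ^+ j.
  by apply: ucauchy; rewrite exprn_gt0// invr_gt0.
(* The sum puts both [idx j] and [idx j.+1] beyond [N j], so consecutive terms are [4^-j] close; the
   summand [j] gives [j <= idx j], so Cauchy bounds of [u] pass to the subsequence. *)
pose idx j := (j + \sum_(i < j.+1) N i)%N.
have idxN j : (N j <= idx j)%N by rewrite /idx big_ord_recr/= addnA leq_addl.
have idxS j : (N j <= idx j.+1)%N.
  by rewrite /idx 2!big_ord_recr (leq_trans _ (leq_addl _ _))//= -addnA addnCA leq_addr.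
pose f j := u (idx j).
have fd j : L2norm (f j.+1 - f j) ^+ 2 <= 16^-1 ^+ j.
  rewrite (_ : 16^-1 ^+ j = (4^-1 ^+ j) ^+ 2).
    by rewrite ler_sqr ?nnegrE ?L2norm_ge0 ?exprn_ge0 ?invr_ge0//; exact: hN.
  by rewrite exprAC; congr (_ ^+ _); field.
(* The weighted sum of the squared increments is integrable, hence finite almost everywhere,
   and then the increments are dominated by a geometric series. *)
pose t j x : \bar R := ((4 ^+ j * normc (f j.+1 x - f j x) ^+ 2)%:E)%E.
have t0 j x : (0 <= t j x)%E by rewrite lee_fin mulr_ge0 ?sqr_ge0 ?exprn_ge0.
have mt j : measurable_fun setT (t j).
  rewrite /t; under eq_fun do rewrite EFinM.
  apply: emeasurable_funM => //; apply: measurable_normc_sqr.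
  by apply: cmeasurableB; exact: cmeasurable_L2.
pose G x := (\sum_(0 <= j <oo) t j x)%E.
have mG : measurable_fun setT G by apply: ge0_emeasurable_sum => // k x _ _; exact: t0.
have G0 x : (0 <= G x)%E by apply: nneseries_ge0 => j _ _; exact: t0.
have Gfin : (\int[mu]_x G x < +oo)%E.
  rewrite integral_nneseries//.
  have it j : (\int[mu]_x t j x = (4 ^+ j * L2norm (f j.+1 - f j) ^+ 2)%:E)%E.
    rewrite /t; under eq_integral do rewrite EFinM.
    rewrite ge0_integralZl_EFin//; first by rewrite integral_normcB_sqr.
    - by move=> x _; rewrite lee_fin sqr_ge0.
    - by apply: measurable_normc_sqr; apply: cmeasurableB; exact: cmeasurable_L2.
  under eq_eseriesr do rewrite it.
  apply: (@le_lt_trans _ _ (\sum_(0 <= j <oo) (4^-1 ^+ j)%:E)%E).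
    apply: lee_nneseries => j _; first by rewrite lee_fin mulr_ge0 ?sqr_ge0 ?exprn_ge0.
    rewrite lee_fin (le_trans (ler_wpM2l _ (fd j)))// ?exprn_ge0// -exprMn.
    by rewrite (_ : 4 * 16^-1 = 4^-1 :> R)//; field.
  have := @cvg_geometric_series R 1 4^-1.
  have n4 : `|4^-1 : R| < 1 by rewrite ger0_norm// invf_lt1// ltr1n.
  move=> /(_ n4) /cvgn_EFin h4.
  rewrite (_ : (fun n => _) = (fun n => (series (geometric 1 4^-1) n : R)%:E)).
    by rewrite (cvg_lim _ h4)// ltry.
  by apply/funext => n /=; rewrite sumEFin; congr (_%:E); apply: eq_bigr => j _; rewrite /= mul1r.
pose Z := [set x | (G x < +oo)%E].
have mZ : measurable Z.
  by rewrite -[Z]setTI; apply: emeasurable_fun_infty_o.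
have aeZ : {ae mu, forall x, Z x}.
  have /(@integrable_ae _ _ _ mu _ measurableT) : mu.-integrable setT G.
    by apply/integrableP; split=> //; under eq_integral do rewrite gee0_abs//.
  by apply: filterS => x /(_ I); rewrite /Z /= ge0_fin_numE.
have gZ x : Z x -> exists C, forall j, normc (f j.+1 x - f j x) <= C * 2^-1 ^+ j.
  move=> Zx; have Gf : G x \is a fin_num by rewrite ge0_fin_numE.
  exists (Num.sqrt (fine (G x))) => j.
  have : (t j x <= G x)%E.
    apply: le_trans (nneseries_lim_ge j.+1 _); last by move=> *; exact: t0.
    by rewrite big_nat_recr//= leeDr// sume_ge0.
  move=> htG; have h : 4 ^+ j * normc (f j.+1 x - f j x) ^+ 2 <= fine (G x).
    by rewrite -lee_fin fineK.
  rewrite -ler_sqr ?nnegrE ?normc_ge0 ?mulr_ge0 ?sqrtr_ge0 ?exprn_ge0 ?invr_ge0//.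
  rewrite exprMn sqr_sqrtr ?fine_ge0// exprAC (_ : 2^-1 ^+ 2 = 4^-1 :> R); last by field.
  by rewrite exprVn ler_pdivlMr ?exprn_gt0// mulrC.
have cRe x : Z x -> cvgn (fun j => Re (f j x)).
  move=> /gZ[C hC]; apply: (@cvg_of_geometric _ C) => j.
  apply: le_trans (hC j); apply: le_trans (Re_le_normc _).
  by case: (f j.+1 x) (f j x) => [? ?] [? ?].
have cIm x : Z x -> cvgn (fun j => Im (f j x)).
  move=> /gZ[C hC]; apply: (@cvg_of_geometric _ C) => j.
  apply: le_trans (hC j); apply: le_trans (Im_le_normc _).
  by case: (f j.+1 x) (f j x) => [? ?] [? ?].
(* The indicator of [Z] makes the limits exist at every point, so that [phi] is measurable as a
   pointwise limit. *)
pose phi x : R[i] := (limn (fun j => Re (f j x) * \1_Z x)) +i*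
  (limn (fun j => Im (f j x) * \1_Z x)).
have cP (p : R[i] -> R) x : (Z x -> cvgn (fun j => p (f j x))) ->
    cvgn (fun j => p (f j x) * \1_Z x).
  move=> h; rewrite indicE; have [/set_mem/h {}h|_] := boolP (x \in Z).
    by apply: is_cvgM => //; exact: is_cvg_cst.
  by under eq_fun do rewrite mulr0; exact: is_cvg_cst.
have mphi : cmeasurable phi.
  split.
    apply: (@measurable_fun_cvg _ _ _ _ (fun j x => Re (f j x) * \1_Z x)) => [j|x _].
      by apply: measurable_funM; [case: (cmeasurable_L2 (f j))|exact: measurable_indic].
    by apply: cP; exact: cRe.
  apply: (@measurable_fun_cvg _ _ _ _ (fun j x => Im (f j x) * \1_Z x)) => [j|x _].
    by apply: measurable_funM; [case: (cmeasurable_L2 (f j))|exact: measurable_indic].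
  by apply: cP; exact: cIm.
have fphi : {ae mu, forall x, f ^~ x @ \oo --> phi x}.
  apply: filterS aeZ => x Zx; rewrite /phi indicE mem_set//.
  have -> : (fun j => Re (f j x) * true%:R) = (fun j => Re (f j x)).
    by apply/funext => j; rewrite mulr1.
  have -> : (fun j => Im (f j x) * true%:R) = (fun j => Im (f j x)).
    by apply/funext => j; rewrite mulr1.
  by apply: cvg_ReIm; [exact: cRe|exact: cIm].
(* Used with [v = u M] to see that [phi] is square integrable, and with [v = u n] to get convergence
   of the whole sequence. *)
have dist v eps M : (forall i, (M <= i)%N -> L2norm (f i - v) <= eps) ->
    (\int[mu]_x (normc (phi x - v x) ^+ 2)%:E <= (eps ^+ 2)%:E)%E.
  move=> /fatou_L2; apply: le_trans; rewrite le_eqVlt; apply/orP; left; apply/eqP.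
  apply: ae_eq_integral => //.
  - by apply: measurable_normc_sqr; apply: cmeasurableB => //; exact: cmeasurable_L2.
  - apply: measurable_limn_einf => n.
    by apply: measurable_normc_sqr; apply: cmeasurableB; exact: cmeasurable_L2.
  apply: filterS fphi => x fx _.
  have h : normc (f i x - v x) ^+ 2 @[i --> \oo] --> normc (phi x - v x) ^+ 2.
    by apply: cvg_sqr; apply: cvg_normc; apply: cvgB fx _; exact: cvg_cst.
  by rewrite ((cvg_limn_einf_sup (cvgn_EFin h)).1).
have idx_ge i : (i <= idx i)%N by exact: leq_addr.
have phi_si : square_integrable mu phi.
  have [M hM] := ucauchy 1 ltr01.
  have -> : phi = (fun x => 1 * (phi x - u M x) + u M x).
    by apply/funext => x; rewrite mul1r subrK.
  apply: square_integrable_lin; last exact: L2_fun_si.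
  split; first by apply: cmeasurableB => //; exact: cmeasurable_L2.
  apply: (le_lt_trans (dist (u M) 1 M _)); last by rewrite ltry.
  by move=> i Mi; apply: hM => //; exact: leq_trans (idx_ge i).
have [w wphi] := L2_of_fun phi_si; exists w.
apply/L2cvgP/cvgrPdist_le => eps eps0; have [M hM] := ucauchy eps eps0.
exists M => // n /= Mn; rewrite sub0r normrN ger0_norm ?L2norm_ge0// L2norm_distC.
rewrite -ler_sqr ?nnegrE ?L2norm_ge0 ?(ltW eps0)// -lee_fin -integral_normcB_sqr.
apply: le_trans (dist (u n) eps M _); last first.
  by move=> i Mi; apply: hM => //; exact: leq_trans (idx_ge i).
rewrite le_eqVlt; apply/orP; left; apply/eqP; apply: ae_eq_integral => //.
- by apply: measurable_normc_sqr; apply: cmeasurableB; exact: cmeasurable_L2.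
- by apply: measurable_normc_sqr; apply: cmeasurableB => //; exact: cmeasurable_L2.
- by apply: filterS wphi => x h xT; rewrite h.
Qed.

(** By orthonormality the squared norm of a block of the series is the corresponding block of the
    scalar series, so partial sums are Cauchy and completeness supplies the limit. *)
Lemma basis_series_cvg (e : nat -> H) (a : nat -> R[i]) :
  (forall i j, inner (e i) (e j) = (i == j)%:R) ->
  cvgn (series (fun k => normc (a k) ^+ 2)) ->
  exists w, series (fun k => a k *: e k) @ \oo --> w.
Proof.
move=> e_ortho ca; apply: L2_complete => eps eps0.
have /cauchy_cvgP/cauchy_seriesP := ca => /(_ (eps ^+ 2)); rewrite exprn_gt0// => /(_ isT).
move=> [[A B] [[M1 _ hA] [M2 _ hB]] hM]; exists (maxn M1 M2).
have h m n : (maxn M1 M2 <= m)%N -> (m <= n)%N ->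
    L2norm (series (fun k => a k *: e k) n - series (fun k => a k *: e k) m) <= eps.
  rewrite geq_max => /andP[M1m M2m] mn.
  rewrite sub_series_geq// -ler_sqr ?nnegrE ?L2norm_ge0 ?(ltW eps0)// L2norm_basis_sum//.
  have /= := hM (m, n) (conj (hA m M1m) (hB n (leq_trans M2m mn))).
  by move=> /ltW; exact: le_trans (ler_norm _).
move=> m n Mm Mn; have [mn|/ltnW nm] := leqP m n; last exact: h.
by rewrite L2norm_distC; exact: h.
Qed.

End completeness.

(** * Diagonal operators *)

Section diagonal.
Context d (T : measurableType d) (R : realType) (mu : {measure set T -> \bar R}).
Local Notation H := (L2 mu).
Implicit Types (u v w g h : H).

(** Polarization: the forms at [g + h] and [g + i h] determine [inner g (S h)]. The functional
    calculus is specified by its quadratic form only, so this is how operators are identified. *)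
Lemma linear_form_ext (S S' : H -> H) : linear S -> linear S' ->
  (forall h, inner h (S h) = inner h (S' h)) -> S = S'.
Proof.
move=> lS lS' SS'.
have SD g h : S (g + h) = S g + S h by have := lS 1 g h; rewrite !scale1r.
have SD' g h : S' (g + h) = S' g + S' h by have := lS' 1 g h; rewrite !scale1r.
have S0 : S 0 = 0 by apply: (@addrI _ (S 0)); rewrite -SD !addr0.
have S0' : S' 0 = 0 by apply: (@addrI _ (S' 0)); rewrite -SD' !addr0.
have SZ a h : S (a *: h) = a *: S h by have := lS a h 0; rewrite S0 !addr0.
have SZ' a h : S' (a *: h) = a *: S' h by have := lS' a h 0; rewrite S0' !addr0.
apply/funext => h; apply: inner_ext => g.
have h1 := SS' (g + h); have hi := SS' (g + 'i%C *: h).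
have hg := SS' g; have hh := SS' h.
move: h1 hi; rewrite SD SD' SD SD' SZ SZ'.
rewrite !innerDl !innerDr !innerZl !innerZr hg hh.
move: (inner g (S h)) (inner g (S' h)) (inner h (S g)) (inner h (S' g)).
move: (inner g (S' g)) (inner h (S' h)).
move=> [e1 e2] [f1 f2] [a1 a2] [b1 b2] [c1 c2] [d1 d2].
rewrite /conjc /= => -[x1 x2] [y1 y2].
by congr (_ +i* _); lra.
Qed.

Variable e : nat -> H.
Hypothesis he : hilbert_basis e.
Let e_ortho : forall i j, inner (e i) (e j) = (i == j)%:R := he.1.

Lemma basis_series_coef (a : nat -> R[i]) w j :
  series (fun k => a k *: e k) @ \oo --> w -> inner (e j) w = a j.
Proof.
move=> /(cvg_innerr (g := e j)) h.
apply: (cvg_unique (@norm_hausdorff _ R[i]) h).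
apply: cvg_near_cst; exists j.+1 => // n /= jn.
by rewrite /series /= inner_basis_sum// jn mul1r.
Qed.

(** Chosen through its coefficients, which determine it. For bounded [m] completeness shows that
    such a vector exists; otherwise [get] may return its default. *)
Definition diag (m : nat -> R[i]) h : H :=
  get [set w | forall k, inner (e k) w = m k * inner (e k) h].

Section bounded_diag.
Variables (m : nat -> R[i]) (M : R).
Hypothesis mM : forall k, normc (m k) <= M.

Let M0 : 0 <= M. Proof. exact: le_trans (normc_ge0 _) (mM 0). Qed.

Lemma inner_basis_diag h k : inner (e k) (diag m h) = m k * inner (e k) h.
Proof.
rewrite /diag; case: xgetP => [w _ /= ->//|/(_ _)/= noex].
have [w hw] : exists w, series (fun k => (m k * inner (e k) h) *: e k) @ \oo --> w.
  apply: basis_series_cvg => //; apply: (@series_le_cvg_bound _ _ (M ^+ 2 * L2norm h ^+ 2)).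
    by move=> j; rewrite sqr_ge0.
  move=> n; apply: le_trans (_ : M ^+ 2 * \sum_(0 <= j < n) normc (inner (e j) h) ^+ 2 <= _).
    rewrite mulr_sumr; apply: ler_sum => j _; rewrite Normc.normcM exprMn.
    by rewrite ler_wpM2r ?sqr_ge0// ler_sqr ?nnegrE ?normc_ge0.
  by rewrite ler_wpM2l ?sqr_ge0// bessel.
by exfalso; apply: (noex w) => j; exact: (basis_series_coef j hw).
Qed.

Lemma diag_linear : linear (diag m).
Proof.
move=> a g h; apply: (basis_ext he) => k.
by rewrite innerDr innerZr !inner_basis_diag innerDr innerZr; ring.
Qed.

Lemma L2norm_diag h : L2norm (diag m h) <= M * L2norm h.
Proof.
rewrite -ler_sqr ?nnegrE ?mulr_ge0 ?L2norm_ge0// exprMn.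
have := parseval_norm he (h := diag m h) => /(cvg_lim (@Rhausdorff R)) <-.
apply: limr_le; first exact: cvgP (parseval_norm he (h := diag m h)).
apply: nearW => n; apply: le_trans (_ : M ^+ 2 * \sum_(0 <= j < n) normc (inner (e j) h) ^+ 2 <= _).
  rewrite mulr_sumr; apply: ler_sum => j _; rewrite inner_basis_diag Normc.normcM exprMn.
  by rewrite ler_wpM2r ?sqr_ge0// ler_sqr ?nnegrE ?normc_ge0.
by rewrite ler_wpM2l ?sqr_ge0// bessel.
Qed.

Lemma bounded_diag : bounded_operator (diag m).
Proof.
split; first exact: diag_linear.
by exists M => h; rewrite !L2_normE -rmorphM lecR L2norm_diag.
Qed.

Lemma diag_series h : series (fun k => (m k * inner (e k) h) *: e k) @ \oo --> diag m h.
Proof.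
by have := basis_expansion he (h := diag m h); under eq_fun do rewrite inner_basis_diag.
Qed.

Lemma inner_diag h :
  series (fun k => m k * (normc (inner (e k) h) ^+ 2)%:C) @ \oo --> inner h (diag m h).
Proof.
have := parseval he (g := h) (h := diag m h); under eq_fun do rewrite inner_basis_diag.
apply: cvg_eqfun => n; rewrite /series /=; apply: eq_bigr => k _.
by rewrite -conj_mul_normc mulrCA.
Qed.

Lemma diag_eq (S : H -> H) : linear S ->
  (forall h, series (fun k => m k * (normc (inner (e k) h) ^+ 2)%:C) @ \oo --> inner h (S h)) ->
  S = diag m.
Proof.
move=> lS hS; apply: linear_form_ext => // [|h]; first exact: diag_linear.
exact: (cvg_unique (@norm_hausdorff _ R[i]) (hS h) (inner_diag (h := h))).
Qed.

End bounded_diag.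

Lemma diag_basis (m : nat -> R[i]) (M : R) k : (forall k, normc (m k) <= M) ->
  diag m (e k) = m k *: e k.
Proof.
move=> mM; apply: (basis_ext he) => j; rewrite (inner_basis_diag mM) innerZr e_ortho.
by have [->|] := eqVneq j k; rewrite ?mulr0.
Qed.

(** On a finite partial sum [p] of [h] the operators agree for large [n]; on [h - p] they are
    controlled by the common bound [M]. This yields the countable additivity of the point
    projections. *)
Lemma cvg_diag (m_ : nat -> nat -> R[i]) (m : nat -> R[i]) (M : R) h :
  (forall n k, normc (m_ n k) <= M) -> (forall k, normc (m k) <= M) ->
  (forall k, \forall n \near \oo, m_ n k = m k) ->
  diag (m_ n) h @[n --> \oo] --> diag m h.
Proof.
move=> mM_ mM mm; apply/L2cvgP/cvgrPdist_le => eps eps0.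
have M0 : 0 <= M := le_trans (normc_ge0 _) (mM 0).
have M1 : 0 < 2 * M + 1 by rewrite ltr_wpDl// mulr_ge0.
(* The remainder costs [2 * M] times its norm; adding 1 keeps the divisor positive when [M = 0]. *)
have := basis_expansion he (h := h) => /L2cvgP/cvgrPdist_le/(_ (eps / (2 * M + 1))).
rewrite divr_gt0// => /(_ isT)[K _ /(_ K (leqnn K))].
rewrite sub0r normrN ger0_norm ?L2norm_ge0//.
set p := series _ K => hp.
have : \forall n \near \oo, forall k, (k < K)%N -> m_ n k = m k.
  elim: K {p hp} => [|K ih]; first exact: nearW.
  apply: filterS2 ih (mm K) => n h1 h2 k; rewrite ltnS leq_eqVlt => /predU1P[->//|].
  exact: h1.
apply: filterS => n hn; rewrite sub0r normrN ger0_norm ?L2norm_ge0//.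
have pp : diag (m_ n) p = diag m p.
  apply: (basis_ext he) => j; rewrite (inner_basis_diag (mM_ n)) (inner_basis_diag mM).
  rewrite /p /series /= inner_basis_sum//.
  by have [/hn ->//|] := boolP (j < K)%N; rewrite mul0r !mulr0.
have dE (m' : nat -> R[i]) : (forall k, normc (m' k) <= M) ->
    diag m' h = diag m' (h - p) + diag m' p.
  by move=> m'M; have := diag_linear m'M 1 (h - p) p; rewrite !scale1r subrK.
rewrite dE// (dE m)// pp opprD addrACA subrr addr0.
rewrite (le_trans (L2normD _ _))// L2normN.
apply: le_trans (_ : M * L2norm (h - p) + M * L2norm (h - p) <= _).
  by rewrite lerD// L2norm_diag.
rewrite -mulrDl -mulr2n -mulr_natl.
apply: le_trans (_ : (2 * M + 1) * L2norm (p - h) <= _).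
  by rewrite L2norm_distC ler_wpM2r ?L2norm_ge0// lerDl.
by rewrite mulrC -ler_pdivlMr.
Qed.

Section point_spectral_measure.
Variable lam : nat -> R.

Definition point_proj (B : set R) : H -> H := diag (fun k => (lam k \in B)%:R).

Let ind_le1 (B : set R) k : normc ((lam k \in B)%:R : R[i]) <= 1.
Proof. by case: (_ \in _); rewrite ?Normc.normc0 ?Normc.normc1. Qed.

Lemma inner_point_proj B h k :
  inner (e k) (point_proj B h) = (lam k \in B)%:R * inner (e k) h.
Proof. exact: (inner_basis_diag (ind_le1 B)). Qed.

Lemma point_proj_sym B g h : inner g (point_proj B h) = inner (point_proj B g) h.
Proof.
have h1 := parseval he (g := g) (h := point_proj B h).
have h2 := parseval he (g := point_proj B g) (h := h).
apply: (cvg_unique (@norm_hausdorff _ R[i]) h1); apply: cvg_eqfun h2 => n.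
rewrite /series /=; apply: eq_bigr => k _; rewrite !inner_point_proj.
by case: (_ \in _); rewrite ?mul1r// !mul0r rmorph0 mul0r mulr0.
Qed.

(** By disjointness the partial sums are the projections of the finite unions. Each diagonal entry
    is eventually constant, since [lam k] enters the union at one index or never, and [cvg_diag]
    applies. *)
Lemma point_proj_bigcup (F : (set R)^nat) h :
  trivIset setT F ->
  series (fun k => point_proj (F k) h) @ \oo --> point_proj (\bigcup_k F k) h.
Proof.
move=> tF.
have -> : series (fun k => point_proj (F k) h) =
    fun n => diag (fun k => (lam k \in \big[setU/set0]_(i < n) F i)%:R) h.
  apply/funext; elim=> [|n ih].
    rewrite /series /= big_geq// big_ord0; apply: (basis_ext he) => k.
    by rewrite -/(point_proj set0 h) inner_point_proj inner0r in_set0 mul0r.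
  rewrite seriesSr ih; apply: (basis_ext he) => k.
  rewrite innerDr -!/(point_proj _ h) !inner_point_proj -mulrDl -natrD.
  congr (_%:R * _); rewrite big_ord_recr/= in_setU.
  case: (boolP (lam k \in F n)) => [kn|]; last by rewrite orbF addn0.
  case: (boolP (lam k \in _)) => //=.
  rewrite inE -bigcup_mkord => -[i /= ni Fi].
  move: tF => /trivIsetP/(_ i n I I); rewrite lt_eqF// => /(_ isT)/seteqP[+ _].
  by move=> /(_ (lam k) (conj Fi (set_mem kn))).
apply: (cvg_diag (M := 1)) => // k.
have [/set_mem[i _ Fi]|] := boolP (lam k \in \bigcup_k F k).
  exists i.+1 => // n /= ni; congr (_%:R); rewrite mem_set// -bigcup_mkord.
  by exists i.
move=> /negP nF; apply: nearW => n; rewrite memNset// -bigcup_mkord => -[i _ Fi].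
by apply: nF; apply/mem_set; exists i.
Qed.

(** Closed with [Defined] so that its projections reduce to [point_proj]. *)
Definition point_spectral_measure : spectral_measure mu.
Proof.
refine (@SpectralMeasure _ _ _ mu point_proj _ _ _ _ _ _).
- by move=> B _; exact: diag_linear (ind_le1 B).
- by move=> B g h _; exact: point_proj_sym.
- by move=> h; apply: (basis_ext he) => k; rewrite inner_point_proj in_set0 mul0r inner0r.
- by move=> h; apply: (basis_ext he) => k; rewrite inner_point_proj in_setT mul1r.
- move=> B B' h _ _; apply: (basis_ext he) => k; rewrite !inner_point_proj in_setI.
  by rewrite mulrA -natrM mulnb.
- by move=> F h _; exact: point_proj_bigcup.
Defined.

End point_spectral_measure.
End diagonal.

(** * Integration against a discrete measure *)

Section discrete_measure.
Context (R : realType) (nu : {measure set R -> \bar R}) (lam : nat -> R) (c : nat -> R).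
Hypothesis c_ge0 : forall k, 0 <= c k.
Hypothesis nuE : forall B, measurable B ->
  nu B = (\sum_(0 <= k <oo) (c k * (lam k \in B)%:R)%:E)%E.

Let range_lam_measurable : measurable (range lam).
Proof.
apply: countable_measurable => [t|]; first exact: measurable_set1.
exact: card_image_le.
Qed.

Let nu_range_lamC : nu (~` range lam) = 0%E.
Proof.
rewrite nuE; last exact: measurableC.
apply: eseries0 => k _ _; rewrite memNset ?mulr0//= => h; apply: h.
by exists k.
Qed.

(* [g] and [g'] need not be measurable: the integral of a nonnegative function is a
   supremum over the simple functions below it. *)
Let ge0_integral_eq_on_range (g g' : R -> \bar R) : (forall x, 0 <= g x)%E ->
  (forall x, 0 <= g' x)%E -> (forall k, g (lam k) = g' (lam k)) ->
  (\int[nu]_x g x <= \int[nu]_x g' x)%E.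
Proof.
move=> g0 g'0 gg'; rewrite !ge0_integralTE//.
apply: ge_ereal_sup => _ [h /= hg <-].
(* Cutting [h] off outside [range lam] changes it on a null set only, and puts it below [g']: the
   two integrands agree on the range, and [g'] is nonnegative elsewhere. *)
pose h' := proj_nnsfun h range_lam_measurable.
have h'E x : h' x = if x \in range lam then h x else 0 by rewrite /h' -mrestrict patchE.
have -> : sintegral nu h = sintegral nu h'.
  rewrite -!integralT_nnsfun; apply: ae_eq_integral => //.
  - exact/measurable_EFinP.
  - exact/measurable_EFinP.
  exists (~` range lam); split => //; first exact: measurableC.
  move=> x /= hx rx; apply: hx => _; congr (_%:E).
  by have /= := h'E x; rewrite mem_set//= => ->.
apply: ereal_sup_ubound; exists h' => // x /=; have /= -> := h'E x.
by case: ifPn => [/set_mem[k _ <-]|_]; [rewrite -gg'|].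
Qed.

(** The integral is first moved to [range lam], where [nu] is a series of weighted Dirac measures
    and every subset is countable, hence Borel. Asking only that [D] contain the [lam k] lets [D] be
    the spectrum. *)
Lemma ge0_integral_discrete (D : set R) (g : R -> \bar R) : (forall x, 0 <= g x)%E ->
  (forall k, D (lam k)) ->
  (\int[nu]_(x in D) g x = \sum_(0 <= k <oo) (c k)%:E * g (lam k))%E.
Proof.
move=> g0 Dlam.
have -> : (\int[nu]_(x in D) g x = \int[nu]_(x in range lam) g x)%E.
  rewrite integral_mkcond [RHS]integral_mkcond.
  have p0 (A : set R) x : (0 <= (g \_ A) x)%E by rewrite patchE; case: ifP.
  apply/eqP; rewrite eq_le; apply/andP; split; apply: ge0_integral_eq_on_range => // k;
    by rewrite !patchE !mem_set//; exists k.
pose m k : {measure set R -> \bar R} := mscale (NngNum (c_ge0 k)) (\d_(lam k)).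
have nuE' : forall B, measurable B -> B `<=` range lam -> nu B = mseries m 0 B.
  move=> B mB _; rewrite nuE// /mseries; apply: eq_eseriesr => k _.
rewrite (eq_measure_integral _ nuE').
have mg : measurable_fun (range lam) g.
  move=> _ Y mY; apply: countable_measurable => [t|]; first exact: measurable_set1.
  exact: sub_countable (subset_card_le (@subIsetl _ _ _)) (card_image_le _ _).
rewrite ge0_integral_measure_series//; apply: eq_eseriesr => k _.
by rewrite /m ge0_integral_mscale// integral_dirac//= diracE mem_set ?mul1e//; exists k.
Qed.

Lemma Rintegral_discrete (D : set R) (f : R -> R) : (forall k, D (lam k)) ->
  cvgn (series (fun k => c k * `|f (lam k)|)) ->
  series (fun k => c k * f (lam k)) @ \oo --> \int[nu]_(x in D) f x.
Proof.
move=> Dlam cf.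
(* Handles the positive and the negative part of [f] at once; both are dominated by [|f|]. *)
have pos (p : R -> R) : (forall x, 0 <= p x) -> (forall x, p x <= `|f x|) ->
    exists2 l : R, series (fun k => c k * p (lam k)) @ \oo --> l &
      (\int[nu]_(x in D) (p x)%:E)%E = l%:E.
  move=> p0 pf.
  have cp : cvgn (series (fun k => c k * p (lam k))).
    apply: (series_le_cvg _ _ _ cf) => k; rewrite ?mulr_ge0//.
    by rewrite ler_wpM2l.
  exists (limn (series (fun k => c k * p (lam k)))) => //.
  rewrite ge0_integral_discrete//; apply: cvg_lim => //.
  apply: cvg_eqfun (cvgn_EFin cp) => n.
  by rewrite /series /= sumEFin.
have fE (x : R) : f x = Num.max (f x) 0 - Num.max (- f x) 0.
  by case: (lerP (f x) 0) => h1; case: (lerP (- f x) 0) => h2; lra.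
have [||l1 h1 e1] := pos (fun x => Num.max (f x) 0) _ _.
- by move=> x; rewrite le_max lexx orbT.
- by move=> x; rewrite ge_max normr_ge0 ler_norm.
have [||l2 h2 e2] := pos (fun x => Num.max (- f x) 0) _ _.
- by move=> x; rewrite le_max lexx orbT.
- by move=> x; rewrite ge_max normr_ge0 -normrN ler_norm.
rewrite /Rintegral integralE.
have -> : (\int[nu]_(x in D) (fun x => (f x)%:E)^\+ x)%E = l1%:E.
  by rewrite -e1; apply: eq_integral => x _; rewrite funeposE EFin_max.
have -> : (\int[nu]_(x in D) (fun x => (f x)%:E)^\- x)%E = l2%:E.
  by rewrite -e2; apply: eq_integral => x _; rewrite funenegE EFin_max.
apply: cvg_eqfun (cvgB h1 h2) => n /=.
rewrite -[LHS]/(series _ n - series _ n) /series /= -sumrB; apply: eq_bigr => k _.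
by rewrite [in RHS]fE mulrBr.
Qed.

Lemma cintegral_discrete (D : set R) (f : R -> R[i]) : (forall k, D (lam k)) ->
  cvgn (series (fun k => c k * normc (f (lam k)))) ->
  series (fun k => f (lam k) * (c k)%:C) @ \oo --> cintegral nu D f.
Proof.
move=> Dlam cf; rewrite /cintegral.
apply: cvg_ReIm => /=.
  apply: cvg_eqfun (Rintegral_discrete Dlam (f := fun x => Re (f x)) _).
    move=> n; rewrite /series /= raddf_sum; apply: eq_bigr => k _.
    by case: (f (lam k)) => a b /=; ring.
  apply: (series_le_cvg _ _ _ cf) => k; rewrite ?mulr_ge0 ?normc_ge0//.
  by rewrite ler_wpM2l// Re_le_normc.
apply: cvg_eqfun (Rintegral_discrete Dlam (f := fun x => Im (f x)) _).
  move=> n; rewrite /series /= raddf_sum; apply: eq_bigr => k _.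
  by case: (f (lam k)) => a b /=; ring.
apply: (series_le_cvg _ _ _ cf) => k; rewrite ?mulr_ge0 ?normc_ge0//.
by rewrite ler_wpM2l// Im_le_normc.
Qed.

End discrete_measure.

(** * Functional calculus of a diagonal operator *)

Section spectral.
Context d (T : measurableType d) (R : realType) (mu : {measure set T -> \bar R}).
Local Notation H := (L2 mu).
Implicit Types (u v w g h : H).

Section projections.
Variable E : spectral_measure mu.

Lemma sproj_add B g h : measurable B -> E B (g + h) = E B g + E B h.
Proof. by move=> mB; have := sproj_linear E mB 1 g h; rewrite !scale1r. Qed.

Lemma sproj_sub B g h : measurable B -> E B (g - h) = E B g - E B h.
Proof.
move=> mB; have := sproj_linear E mB (-1) h g.
by rewrite !scaleN1r ![- _ + _]addrC.
Qed.

Lemma sproj_idem B h : measurable B -> E B (E B h) = E B h.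
Proof. by move=> mB; rewrite -sproj_setI// setIid. Qed.

Lemma inner_sproj_orth B g h : measurable B -> inner (E B g) (h - E B h) = 0.
Proof.
move=> mB; rewrite innerBr (sproj_sym E _ _ mB) sproj_idem// -(sproj_sym E _ _ mB).
by rewrite (sproj_sym E _ _ mB) subrr.
Qed.

Lemma vector_measure_setI B C h : measurable B -> measurable C ->
  vector_measure E (E B h) C = vector_measure E h (C `&` B).
Proof. by move=> mB mC; rewrite /vector_measure sproj_setI. Qed.

Lemma vector_measure_setT h : vector_measure E h setT = (L2norm h ^+ 2)%:E.
Proof. by rewrite /vector_measure sproj_setT. Qed.

(** [E C] commutes with [E B], so the images under [E C] of [E B h] and [h - E B h] stay orthogonal.
    This additivity stands in for a commutation of [A] with [E B]. *)
Lemma vector_measure_split B C h : measurable B -> measurable C ->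
  vector_measure E h C =
  (vector_measure E (E B h) C + vector_measure E (h - E B h)%R C)%E.
Proof.
move=> mB mC; rewrite /vector_measure -EFinD -L2norm_pythagoras.
  by rewrite -sproj_add// addrC subrK.
have EC : E C (E B h) = E B (E C h) by rewrite -!sproj_setI// setIC.
by rewrite sproj_sub// EC inner_sproj_orth.
Qed.

Lemma vector_measure_eq0 h C : vector_measure E h C = 0%E -> E C h = 0.
Proof. by move=> -[] /eqP; rewrite sqrf_eq0 => /eqP/L2norm_eq0. Qed.

Lemma integrable_cst_vector_measure h (x : R) :
  (vector_measure E h).-integrable setT (EFin \o cst x).
Proof.
apply/integrableP; split; first exact/measurable_EFinP.
rewrite (eq_integral (cst `|x|%:E))//.
by rewrite integral_cst//= vector_measure_setT -EFinM ltry.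
Qed.

End projections.

Variables (A : operator mu) (e : nat -> H) (lam : nat -> R).
Hypothesis A_lin : linear_operator A.
Hypothesis A_sa : self_adjoint A.
Hypothesis he : hilbert_basis e.
Hypothesis A_eig : forall k, dom A (e k) /\ A (e k) = (lam k)%:C *: e k.
Let e_ortho : forall i j, inner (e i) (e j) = (i == j)%:R := he.1.

Lemma self_adjoint_sym g h : dom A g -> dom A h -> inner g (A h) = inner (A g) h.
Proof. by move=> dg dh; apply: (A_sa g (A g)).2 dh. Qed.

Lemma inner_eigenvector h k : dom A h -> inner (e k) (A h) = (lam k)%:C * inner (e k) h.
Proof.
move=> dh; have [de Ae] := A_eig k; rewrite self_adjoint_sym// Ae innerZl.
by rewrite /conjc /= oppr0.
Qed.

Section uniqueness.
Variable E : spectral_measure mu.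
Hypothesis hE : is_spectral_measure_of A E.

(* With [g := E B (e k)], comparing [inner g (A (e k)) = lam k * |g|^2] with the spectral
   form of [inner g (A g)] shows that [x - lam k] has integral 0 for the measure of [g];
   it has a constant sign on [B], so [g = 0]. The cross term of [A] between [g] and
   [e k - g] has real part 0 because the measures of these two vectors add up. *)
Lemma sproj_away (s : R) k (B : set R) : measurable B ->
  (forall x, B x -> 0 < s * (x - lam k)) -> E B (e k) = 0.
Proof.
move=> mB Bpos.
have [de Ae] := A_eig k.
set h := e k; set g := E B h; pose g' := h - g.
have hg : h = g + g' by rewrite /g' addrC subrK.
have splitI (f : R -> \bar R) : measurable_fun setT f -> (forall x, 0 <= f x)%E ->
    (\int[vector_measure E h]_x f x =
     \int[vector_measure E g]_x f x + \int[vector_measure E g']_x f x)%E.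
  move=> mf f0; rewrite -ge0_integral_measure_add//.
  apply: eq_measure_integral => C mC _.
    rewrite /measure_add/= /msum !big_ord_recl big_ord0/= adde0.
  exact: vector_measure_split.
have msqr : measurable_fun setT (fun x : R => (x ^+ 2)%:E).
  by apply/measurable_EFinP; exact: measurable_funX.
(* The second moment of [h] is finite and is the sum of the nonnegative second moments of [g] and
   [g']. *)
have [dg dg'] : dom A g /\ dom A g'.
  have := (hE h).1.1 de; rewrite splitI//; last by move=> x; rewrite lee_fin sqr_ge0.
  move=> fin; split; apply: (hE _).1.2; apply: le_lt_trans fin.
    by rewrite leeDl// integral_ge0// => x _; rewrite lee_fin sqr_ge0.
  by rewrite leeDr// integral_ge0// => x _; rewrite lee_fin sqr_ge0.
(* [|x| <= x^2 + 1], and the measure is finite. *)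
have intx v : dom A v -> (vector_measure E v).-integrable setT (fun x => x%:E).
  move=> /((hE v).1.1) fin.
  have i1 : (vector_measure E v).-integrable setT (fun x : R => (x ^+ 2)%:E).
    apply/integrableP; split => //.
    by under eq_integral do rewrite gee0_abs ?lee_fin ?sqr_ge0//.
  have := integrableD measurableT i1 (integrable_cst_vector_measure E v 1).
  apply: le_integrable => //; first exact/measurable_EFinP.
  move=> x _ /=; rewrite lee_fin [leRHS]ger0_norm ?addr_ge0 ?sqr_ge0//.
  by rewrite ler_norml; apply/andP; split; nra.
have qA v : dom A v -> Re (inner v (A v)) = \int[vector_measure E v]_x x.
  by move=> dv; rewrite ((hE v).2 dv).
have finx v : dom A v -> ((\int[vector_measure E v]_x x%:E)%E = (\int[vector_measure E v]_x x)%:E).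
  by move=> dv; rewrite /Rintegral fineK//; exact: (integrable_fin_num measurableT (intx v dv)).
have addA : Re (inner h (A h)) = Re (inner g (A g)) + Re (inner g' (A g')).
  have addI : (\int[vector_measure E h]_x x%:E =
      \int[vector_measure E g]_x x%:E + \int[vector_measure E g']_x x%:E)%E.
    rewrite -integral_measure_add//; [|exact: intx..].
    apply: eq_measure_integral => C mC _.
    rewrite /measure_add/= /msum !big_ord_recl big_ord0/= adde0.
    exact: vector_measure_split.
  apply: (etrans (qA h de)); apply: (etrans _ (congr2 +%R (esym (qA g dg)) (esym (qA g' dg')))).
  apply: EFin_inj; apply: (etrans (esym (finx h de))); apply: (etrans addI).
  exact: (congr2 adde (finx g dg) (finx g' dg')).
have AD : A h = A g + A g'.
  by have := (A_lin.2 1 g g' dg dg').2; rewrite !scale1r -hg.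
have cross : Re (inner g (A g')) = 0.
  have c2 : Re (inner g' (A g)) = Re (inner g (A g')).
    by rewrite (self_adjoint_sym dg dg') inner_conj; case: (inner (A g) g').
  have ReD (x y : R[i]) : Re (x + y) = Re x + Re y by case: x y => [? ?] [? ?].
  move: addA; rewrite AD {1}hg (innerDl g g') (innerDr (A g) (A g') g) (innerDr (A g) (A g') g').
  rewrite !ReD c2; lra.
have gA : Re (inner g (A g)) = lam k * L2norm g ^+ 2.
  have : Re (inner g (A h)) = Re (inner g (A g)).
    rewrite AD (innerDr (A g) (A g') g); move: cross.
    by case: (inner g (A g)) (inner g (A g')) => [? ?] [? ?] /= ->; rewrite addr0.
  have gh : inner g h = (L2norm g ^+ 2)%:C.
    by rewrite {1}hg (innerDr g g' g) inner_L2norm (inner_sproj_orth E h h mB) addr0.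
  move=> <-; rewrite Ae innerZr -/h gh.
  by rewrite -rmorphM.
have int0 : (\int[vector_measure E g]_x (s * (x - lam k))%:E = 0)%E.
  under eq_integral do rewrite mulrBr EFinB [X in (X - _)%E]EFinM.
  have iZ : (vector_measure E g).-integrable setT (fun x => s%:E * x%:E)%E.
    by apply: integrableZl => //; exact: intx.
  rewrite integralB//; last exact: integrable_cst_vector_measure E g (s * lam k).
  rewrite integralZl//; last exact: intx.
  have c1 : (\int[vector_measure E g]_x (s * lam k)%:E = (s * lam k * L2norm g ^+ 2)%:E)%E.
    by rewrite (eq_integral (cst (s * lam k)%:E))// integral_cst//= vector_measure_setT.
  rewrite (finx g dg) -(qA g dg) gA [X in (_ - X)%E]c1 -EFinM -EFinB.
  by congr (_%:E); ring.
have BC0 : vector_measure E g (~` B) = 0%E.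
  rewrite vector_measure_setI//; last exact: measurableC.
  by rewrite setICl /vector_measure sproj_set0 L2norm0 expr0n.
have aeB : {ae vector_measure E g, forall x, B x}.
  by exists (~` B); split => //; exact: measurableC.
have mf : measurable_fun setT (fun x : R => (s * (x - lam k))%:E).
  by apply/measurable_EFinP; apply: measurable_funM => //; apply: measurable_funB.
have /(ae_eq_integral_abs _ measurableT mf) ae0 :
    (\int[vector_measure E g]_x `|(s * (x - lam k))%:E| = 0)%E.
  rewrite -int0; apply: ae_eq_integral => //; first exact: measurableT_comp.
  by apply: filterS aeB => x Bx _; rewrite gee0_abs// lee_fin ltW// Bpos.
(* Almost every point lies in [B], where the integrand is positive, and is also a zero of the
   integrand. So the whole line is null, and its mass is the squared norm of [g]. *)
have : {ae vector_measure E g, forall x, (set0 : set R) x}.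
  apply: filterS2 ae0 aeB => x /(_ I) /= [] h0 /Bpos; by rewrite h0 ltxx.
move=> [N [mN N0 sN]].
have : vector_measure E g setT = 0%E.
  apply/eqP; rewrite eq_le measure_ge0 andbT -N0 le_measure ?inE//.
  by move=> x _; apply: sN => /=.
by move=> /vector_measure_eq0; rewrite sproj_setT.
Qed.

(** The open half-lines on both sides of [lam k] are null for [e k] ([s = 1] and [s = -1] in
    [sproj_away]), hence so is every Borel set missing [lam k]. If [lam k] is in [B], this applies
    to the complement and leaves [E B (e k) = e k]. *)
Lemma sproj_eigenvector B k : measurable B -> E B (e k) = (lam k \in B)%:R *: e k.
Proof.
have away C : measurable C -> ~ C (lam k) -> vector_measure E (e k) C = 0%E.
  move=> mC nC; apply/eqP; rewrite eq_le measure_ge0 andbT.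
  have m1 : measurable (`]lam k, +oo[%classic : set R) by exact: measurable_itv.
  have m2 : measurable (`]-oo, lam k[%classic : set R) by exact: measurable_itv.
  have z1 : vector_measure E (e k) `]lam k, +oo[%classic = 0%E.
    rewrite /vector_measure (@sproj_away 1) ?L2norm0 ?expr0n// => x /=.
    by rewrite in_itv/= andbT mul1r subr_gt0.
  have z2 : vector_measure E (e k) `]-oo, lam k[%classic = 0%E.
    rewrite /vector_measure (@sproj_away (-1)) ?L2norm0 ?expr0n// => x /=.
    by rewrite in_itv/= mulN1r oppr_gt0 subr_lt0.
  apply: (@le_trans _ _ (vector_measure E (e k) `]lam k, +oo[%classic +
      vector_measure E (e k) `]-oo, lam k[%classic)%E); last by rewrite z1 z2 adde0.
  apply: le_trans (measureU2 _ m1 m2); apply: le_measure; rewrite ?inE//; first exact: measurableU.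
  move=> x Cx; rewrite /= !in_itv /= andbT.
  by case: (ltgtP (lam k) x) => [|/=|xl]; [left|right|rewrite xl in nC].
move=> mB; have [/set_mem Bk|nB] := boolP (lam k \in B).
  rewrite scale1r; apply/eqP; rewrite eq_sym -subr_eq0; apply/eqP/L2norm_eq0/eqP.
  rewrite -sqrf_eq0; apply/eqP.
  have nBC : ~ (~` B) (lam k) by [].
  have /(away _ (measurableC mB)) := nBC => c0.
  have : (vector_measure E (e k) setT =
      vector_measure E (e k) B + vector_measure E (e k) (~` B))%E.
    by rewrite -measureU ?setICr ?setUCr//; exact: measurableC.
  rewrite c0 adde0 vector_measure_setT /vector_measure => -[] hB.
  have := L2norm_pythagoras (inner_sproj_orth E (e k) (e k) mB).
  by rewrite addrC subrK hB; lra.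
rewrite scale0r; apply: vector_measure_eq0; apply: away => //.
by move=> Bk; move: nB; rewrite mem_set.
Qed.

Lemma sproj_point_proj B h : measurable B -> E B h = point_proj e lam B h.
Proof.
move=> mB; apply: (basis_ext he) => k; rewrite (inner_point_proj he).
rewrite (sproj_sym E _ _ mB) sproj_eigenvector// innerZl.
by case: (_ \in _); rewrite ?rmorph1 ?rmorph0.
Qed.

End uniqueness.

Lemma vector_measure_discrete (E : spectral_measure mu) :
  (forall B h, measurable B -> E B h = point_proj e lam B h) ->
  forall h B, measurable B -> vector_measure E h B =
   (\sum_(0 <= k <oo) (normc (inner (e k) h) ^+ 2 * (lam k \in B)%:R)%:E)%E.
Proof.
move=> hE h B mB; apply/esym/cvg_lim => //.
rewrite /vector_measure hE//.
apply: cvg_eqfun (cvgn_EFin (parseval_norm he (h := point_proj e lam B h))) => n.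
rewrite /series /= sumEFin; congr (_%:E); apply: eq_bigr => k _.
rewrite (inner_point_proj he); case: (_ \in _); rewrite ?mul1r ?mulr1//.
by rewrite mul0r mulr0 Normc.normc0 expr0n.
Qed.

Lemma is_spectral_point_spectral_measure :
  is_spectral_measure_of A (point_spectral_measure he lam).
Proof.
set E := point_spectral_measure he lam.
have hE B h : measurable B -> E B h = point_proj e lam B h by [].
move=> h; have nuE := vector_measure_discrete hE h.
have c0 k : 0 <= normc (inner (e k) h) ^+ 2 by exact: sqr_ge0.
have domP : dom A h -> cvgn (series (fun k => normc (inner (e k) h) ^+ 2 * lam k ^+ 2)).
  move=> dh; apply: (series_le_cvg_bound (M := L2norm (A h) ^+ 2)) => [k|n].
    by rewrite mulr_ge0 ?sqr_ge0.
  apply: le_trans (bessel e_ortho (A h) n); apply: ler_sum => k _.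
  rewrite inner_eigenvector// Normc.normcM normc_real exprMn mulrC real_normK//.
  exact: num_real.
split; first split.
- move=> /domP ch; rewrite (ge0_integral_discrete c0 nuE)//; last by move=> x; rewrite lee_fin sqr_ge0.
  rewrite (cvg_lim _ (_ : _ --> (limn (series (fun k => normc (inner (e k) h) ^+ 2 * lam k ^+ 2)))%:E))//.
    by rewrite ltry.
  by apply: cvg_eqfun (cvgn_EFin ch) => n; rewrite /series /= -sumEFin.
- rewrite (ge0_integral_discrete c0 nuE)//; last by move=> x; rewrite lee_fin sqr_ge0.
  set S := (\sum_(_ <= _ <oo) _)%E => Sfin.
  have S0 : (0 <= S)%E.
    by apply: nneseries_ge0 => k _ _; rewrite -EFinM lee_fin mulr_ge0 ?sqr_ge0.
  have [w hw] : exists w, series (fun k => ((lam k)%:C * inner (e k) h) *: e k) @ \oo --> w.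
    apply: basis_series_cvg => //; apply: (series_le_cvg_bound (M := fine S)) => [k|n].
      by rewrite sqr_ge0.
    rewrite -lee_fin fineK ?ge0_fin_numE//.
    apply: le_trans (nneseries_lim_ge n _); last first.
      by move=> *; rewrite -EFinM lee_fin mulr_ge0 ?sqr_ge0.
    rewrite sumEFin lee_fin; apply: ler_sum => k _.
    by rewrite Normc.normcM normc_real exprMn mulrC real_normK// num_real.
  (* The candidate [w] for [A h] satisfies [inner h (A h') = inner w h'] for all [h'] in the domain;
     self-adjointness then places [h] in the domain. *)
  suff [] : dom A h /\ A h = w by [].
  apply: (A_sa h w).1 => h' dh'.
  apply: (cvg_unique (@norm_hausdorff _ R[i]) (parseval he (g := h) (h := A h'))).
  apply: cvg_eqfun (parseval he (g := w) (h := h')) => n.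
  rewrite /series /=; apply: eq_bigr => k _.
  rewrite (basis_series_coef he k hw) inner_eigenvector// rmorphM /=.
  rewrite [X in X * _ * _ = _](_ : _ = (lam k)%:C); last by rewrite /conjc /= oppr0.
  by rewrite mulrCA mulrA.
move=> dh.
have := cintegral_discrete c0 nuE (D := setT) (f := fun x => x%:C) (fun=> I).
move=> hc; apply: (cvg_unique (@norm_hausdorff _ R[i]) _ (hc _)).
  apply: cvg_eqfun (parseval he (g := h) (h := A h)) => n.
  rewrite /series /=; apply: eq_bigr => k _.
  by rewrite inner_eigenvector// mulrCA conj_mul_normc.
(* Absolute convergence of the first moment follows from [|x| <= 1 + x^2]. *)
have cs : cvgn (series (fun k => normc (inner (e k) h) ^+ 2 +
    normc (inner (e k) h) ^+ 2 * lam k ^+ 2)).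
  rewrite (_ : series _ = series (fun k => normc (inner (e k) h) ^+ 2) \+
     series (fun k => normc (inner (e k) h) ^+ 2 * lam k ^+ 2)).
    apply: is_cvgD; last exact: domP.
    exact: cvgP (parseval_norm he (h := h)).
  by apply/funext => n; rewrite /series /= -big_split.
apply: (series_le_cvg _ _ _ cs) => k.
- by rewrite mulr_ge0 ?sqr_ge0 ?normc_ge0.
- by rewrite addr_ge0// mulr_ge0 ?sqr_ge0.
- rewrite normc_real -[X in _ <= X + _]mulr1 -mulrDr ler_wpM2l//.
  by rewrite ler_norml; apply/andP; split; nra.
Qed.

(** A resolvent at [lam k] would map [A (e k) - lam k *: e k = 0] back to [e k]. This makes
    assumptions on [f] over the spectrum available at the eigenvalues. *)
Lemma eigenvalue_in_spectrum k : spectrum A (lam k).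
Proof.
move=> [S [[lS _] _ Sinv]]; have [de Ae] := A_eig k.
have := Sinv (e k) de; rewrite Ae subrr => S0.
have lS0 : S 0 = 0.
  have := lS (-1) 0 0; rewrite scaler0 addr0 scaleN1r addNr; exact.
have := e_ortho k k; rewrite -S0 lS0 inner0r eqxx => /eqP.
by rewrite eq_sym oner_eq0.
Qed.

Lemma functional_calculus_diag (f : R -> R[i]) (M : R) :
  (forall k, normc (f (lam k)) <= M) ->
  functional_calculus A f = diag e (f \o lam).
Proof.
move=> fM.
(* Valid for every spectral measure of [A]: first for the explicit one, to show that a functional
   calculus exists, then for the one behind the operator chosen by [get]. *)
have calc (E : spectral_measure mu) h : is_spectral_measure_of A E ->
    series (fun k => f (lam k) * (normc (inner (e k) h) ^+ 2)%:C) @ \oo -->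
    cintegral (vector_measure E h) (spectrum A) f.
  move=> hE; have nuE := vector_measure_discrete (sproj_point_proj hE) h.
  apply: (cintegral_discrete (fun k => sqr_ge0 _) nuE).
    by move=> k; exact: eigenvalue_in_spectrum.
  have cs := cvgP _ (parseval_norm he (h := h)).
  have {}cs : cvgn (M *: series (fun k => normc (inner (e k) h) ^+ 2)).
    exact: is_cvgZr.
  have e1 : M *: series (fun k => normc (inner (e k) h) ^+ 2) =
      series (fun k => M * normc (inner (e k) h) ^+ 2).
    by apply/funext => n; rewrite /series /= -mulr_sumr.
  rewrite e1 in cs; apply: (series_le_cvg _ _ _ cs) => k.
  - by rewrite mulr_ge0 ?sqr_ge0 ?normc_ge0.
  - by rewrite mulr_ge0 ?sqr_ge0// (le_trans (normc_ge0 _) (fM 0)).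
  - by rewrite mulrC ler_wpM2r ?sqr_ge0.
have ex : is_functional_calculus A f (diag e (f \o lam)).
  exists (point_spectral_measure he lam); split.
  - exact: is_spectral_point_spectral_measure.
  - exact: (bounded_diag he (M := M)).
  - move=> h; apply: (cvg_unique (@norm_hausdorff _ R[i]) (inner_diag he (M := M) fM (h := h))).
    exact: calc is_spectral_point_spectral_measure.
have [E [hE [lS _] hS]] := getPex (ex_intro _ _ ex).
apply: (diag_eq he (M := M)) => // h.
by rewrite hS; exact: calc.
Qed.

End spectral.

(** * Series of complex numbers *)

Section complex_series.
Context (R : realType).

Lemma normc_summable_cvg (a : nat -> R[i]) : cvgn (series (fun k => normc (a k))) ->
  cvgn (series a).
Proof.
move=> ca.
have cRe : cvgn (series (fun k => Re (a k))).
  apply: normed_cvg.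
  apply: (@series_le_cvg _ (fun k => `|Re (a k)|) (fun k => normc (a k)) _ _ _ ca) => k.
  - exact: normr_ge0.
  - exact: normc_ge0.
  - exact: Re_le_normc.
have cIm : cvgn (series (fun k => Im (a k))).
  apply: normed_cvg.
  apply: (@series_le_cvg _ (fun k => `|Im (a k)|) (fun k => normc (a k)) _ _ _ ca) => k.
  - exact: normr_ge0.
  - exact: normc_ge0.
  - exact: Im_le_normc.
apply/cvg_ex; exists (limn (series (fun k => Re (a k))) +i* limn (series (fun k => Im (a k)))).
apply: cvg_ReIm => /=.
  by apply: cvg_eqfun cRe => n; rewrite /series /= raddf_sum.
by apply: cvg_eqfun cIm => n; rewrite /series /= raddf_sum.
Qed.

Lemma normc_series_le (a : nat -> R[i]) (b : nat -> R) (l : R[i]) (m : R) :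
  (forall k, normc (a k) <= b k) ->
  series a @ \oo --> l -> series b @ \oo --> m -> normc l <= m.
Proof.
move=> ab al bm; apply: (ler_cvg_to (cvg_normc al) bm).
apply: nearW => n; rewrite /series /=.
by apply: le_trans (normc_sum _ _ _) _; exact: ler_sum.
Qed.

Lemma cvg_linear_combination (T : Type) (F : set_system T) {FF : Filter F}
    (a : nat -> R[i]) (f : nat -> T -> R[i]) (l : nat -> R[i]) N :
  (forall k, f k @ F --> l k) ->
  series (fun k => a k * f k x) N @[x --> F] --> series (fun k => a k * l k) N.
Proof.
move=> fl; elim: N => [|N ih].
  apply: (cvg_eqfun (u := fun=> 0)); last by rewrite /series /= big_geq//; exact: cvg_cst.
  by move=> x; rewrite /series /= big_geq.
apply: (cvg_eqfun (u := fun x => series (fun k => a k * f k x) N + a N * f N x)).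
  by move=> x; rewrite seriesSr.
have -> : series (fun k => a k * l k) N.+1 = series (fun k => a k * l k) N + a N * l N.
  by rewrite seriesSr.
apply: cvgD; first exact: ih.
by apply: cvgM; [exact: cvg_cst|exact: fl].
Qed.

End complex_series.

(** * Complex integrals over sets of finite measure *)

Section complex_integral_bounds.
Context d (T : measurableType d) (R : realType) (nu : {measure set T -> \bar R}).
Implicit Types (D : set T) (f g : T -> R[i]).

Lemma cmeasurable_lin (a : R[i]) f g : cmeasurable f -> cmeasurable g ->
  cmeasurable (fun x => a * f x + g x).
Proof.
case: a => a b [fr fi] [gr gi]; split.
  rewrite (_ : (fun _ => _) = (fun x => a * Re (f x) - b * Im (f x) + Re (g x))).
    by apply: measurable_funD => //; apply: measurable_funB => //;
      apply: measurable_funM.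
  by apply/funext => x; case: (f x) (g x) => [? ?] [? ?].
rewrite (_ : (fun _ => _) = (fun x => a * Im (f x) + b * Re (f x) + Im (g x))).
  by apply: measurable_funD => //; apply: measurable_funD => //;
    apply: measurable_funM.
by apply/funext => x; case: (f x) (g x) => [? ?] [? ?].
Qed.

Lemma cmeasurableM f g : cmeasurable f -> cmeasurable g ->
  cmeasurable (fun x => f x * g x).
Proof.
move=> [fr fi] [gr gi]; split.
  rewrite (_ : (fun _ => _) = (fun x => Re (f x) * Re (g x) - Im (f x) * Im (g x))).
    by apply: measurable_funB => //; apply: measurable_funM.
  by apply/funext => x; case: (f x) (g x) => [? ?] [? ?].
rewrite (_ : (fun _ => _) = (fun x => Re (f x) * Im (g x) + Im (f x) * Re (g x))).
  by apply: measurable_funD => //; apply: measurable_funM.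
by apply/funext => x; case: (f x) (g x) => [? ?] [? ?].
Qed.

Lemma cmeasurable0 : cmeasurable (fun _ : T => 0 : R[i]).
Proof. by split; exact: measurable_cst. Qed.

Lemma cmeasurable_sum (a : nat -> R[i]) (f : nat -> T -> R[i]) n :
  (forall k, cmeasurable (f k)) ->
  cmeasurable (fun x => \sum_(0 <= k < n) a k * f k x).
Proof.
move=> mf; elim: n => [|n ih].
  by under eq_fun do rewrite big_geq//; exact: cmeasurable0.
by under eq_fun do rewrite big_nat_recr//= addrC; exact: cmeasurable_lin.
Qed.

Lemma cmeasurable_cvg (f : nat -> T -> R[i]) g : (forall n, cmeasurable (f n)) ->
  (forall x, f ^~ x @ \oo --> g x) -> cmeasurable g.
Proof.
move=> mf fg; split.
  apply: (@measurable_fun_cvg _ _ _ _ (fun n x => Re (f n x))) => [n|x _].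
    by case: (mf n).
  exact: cvg_Re (fg x).
apply: (@measurable_fun_cvg _ _ _ _ (fun n x => Im (f n x))) => [n|x _].
  by case: (mf n).
exact: cvg_Im (fg x).
Qed.

Lemma cintegralB D f g : measurable D -> cintegrable nu D f -> cintegrable nu D g ->
  cintegral nu D (fun x => f x - g x) = cintegral nu D f - cintegral nu D g.
Proof.
move=> mD fi gi; rewrite [RHS]addrC -mulN1r -cintegral_lin//; congr (cintegral _ _ _).
by apply/funext => x; rewrite mulN1r addrC.
Qed.

Section finite_domain.
Variables (D : set T) (m : R).
Hypotheses (mD : measurable D) (nuD : nu D = m%:E).

Let integrable_bounded (h : T -> R) B : measurable_fun setT h ->
  (forall x, D x -> `|h x| <= B) ->
  nu.-integrable D (EFin \o h) /\ `|\int[nu]_(x in D) h x| <= B * m.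
Proof.
move=> mh hB.
have icst : nu.-integrable D (EFin \o cst B).
  apply/integrableP; split; first exact/measurable_EFinP.
  by rewrite (eq_integral (cst `|B|%:E))// integral_cst//= nuD -EFinM ltry.
have ih : nu.-integrable D (EFin \o h).
  apply: le_integrable icst => //; first exact/measurable_EFinP/measurable_funTS.
  by move=> x Dx; rewrite /= lee_fin (le_trans (hB x Dx))// ler_norm.
split=> //; apply: le_trans (le_normr_Rintegral mD ih) _.
have -> : B * m = \int[nu]_(x in D) cst B x by rewrite Rintegral_cst// nuD.
apply: le_Rintegral => //.
by have := integrable_norm ih; apply: eq_integrable.
Qed.

Lemma cintegrable_bounded f B : cmeasurable f -> (forall x, D x -> normc (f x) <= B) ->
  cintegrable nu D f.
Proof.
move=> [fr fi] fB; split.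
  by apply: (integrable_bounded fr _).1 => x /fB; exact: le_trans (Re_le_normc _).
by apply: (integrable_bounded fi _).1 => x /fB; exact: le_trans (Im_le_normc _).
Qed.

(** The factor 2 comes from estimating real and imaginary parts separately; the later arguments only
    need some finite constant. *)
Lemma normc_cintegral_le f B : cmeasurable f -> (forall x, D x -> normc (f x) <= B) ->
  normc (cintegral nu D f) <= 2 * B * m.
Proof.
move=> [fr fi] fB; apply: le_trans (normc_le_ReIm _) _; rewrite -mulrA mulrDl !mul1r.
apply: lerD => /=.
  by apply: (integrable_bounded fr _).2 => x /fB; exact: le_trans (Re_le_normc _).
by apply: (integrable_bounded fi _).2 => x /fB; exact: le_trans (Im_le_normc _).
Qed.

Lemma cintegral_sum (a : nat -> R[i]) (f : nat -> T -> R[i]) (B : nat -> R) n :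
  (forall k, cmeasurable (f k)) -> (forall k x, D x -> normc (f k x) <= B k) ->
  cintegral nu D (fun x => \sum_(0 <= k < n) a k * f k x) =
  \sum_(0 <= k < n) a k * cintegral nu D (f k).
Proof.
move=> mf fB.
have If k : cintegrable nu D (f k) by apply: (cintegrable_bounded (mf k)) => x; exact: fB.
elim: n => [|n ih].
  under eq_fun do rewrite big_geq//.
  by rewrite big_geq// /cintegral /= !Rintegral_cst//= !mul0r.
rewrite big_nat_recr//= -ih addrC.
under eq_fun do rewrite big_nat_recr//= addrC.
apply: cintegral_lin => //.
apply: (@cintegrable_bounded _ (\sum_(0 <= k < n) normc (a k) * B k)).
  exact: cmeasurable_sum.
move=> x Dx; apply: le_trans (normc_sum _ _ _) _; apply: ler_sum => k _.
by rewrite Normc.normcM ler_wpM2l ?normc_ge0 ?fB.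
Qed.

End finite_domain.
End complex_integral_bounds.

(** * The entire extension of sin (s sqrt z) / sqrt z *)

Section sin_sqrt.
Context (R : realType).
Implicit Types (s t Z : R) (z w : R[i]).

Let term s z k : R[i] := (-1) ^+ k * (s ^+ k.*2.+1 / (k.*2.+1)`!%:R)%:C * z ^+ k.

(** Replacing [(2k+1)!] by [k!] gives an exponential series; the room so left also absorbs the
    factor [k] of the Lipschitz estimate. *)
Let majorant s Z k : R := `|s| * exp_coeff (s ^+ 2 * Z) k.

Let cvg_majorant s Z : series (majorant s Z) @ \oo --> `|s| * expR (s ^+ 2 * Z).
Proof.
have h : (`|s| * series (exp_coeff (s ^+ 2 * Z)) n) @[n --> \oo] --> `|s| * expR (s ^+ 2 * Z).
  by apply: cvgM; [exact: cvg_cst|exact: is_cvg_series_exp_coeff].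
by apply: cvg_eqfun h => n; rewrite /series /= /majorant mulr_sumr.
Qed.

Let normc_coeff s k : normc ((-1) ^+ k * (s ^+ k.*2.+1 / (k.*2.+1)`!%:R)%:C) =
  `|s| * (s ^+ 2) ^+ k / (k.*2.+1)`!%:R.
Proof.
rewrite Normc.normcM normcX normcNl Normc.normc1 expr1n mul1r normc_real.
rewrite normrM normrX normfV normr_nat exprS -mul2n exprM.
by rewrite real_normK// num_real.
Qed.

Let leq_fact m n : (m <= n)%N -> (m`! <= n`!)%N.
Proof.
elim: n => [|n ih]; first by rewrite leqn0 => /eqP ->.
rewrite leq_eqVlt => /predU1P[->//|/ih/leq_trans]; apply.
by rewrite factS leq_pmull.
Qed.

(** The factor [k] comes from the difference of two [k]-th powers; [k * k! <= (k+1)! <= (2k+1)!]. *)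
Let coeff_le k : k%:R / (k.*2.+1)`!%:R <= k`!%:R^-1 :> R.
Proof.
rewrite ler_pdivrMr ?ltr0n ?fact_gt0// ler_pdivlMl ?ltr0n ?fact_gt0//.
rewrite -natrM ler_nat; apply: (@leq_trans k.+1`!); first by rewrite factS mulnC leq_mul.
by rewrite leq_fact// ltnS -addnn leq_addr.
Qed.

Let coeff_le1 k : (k.*2.+1)`!%:R^-1 <= k`!%:R^-1 :> R.
Proof.
rewrite lef_pV2 ?posrE ?ltr0n ?fact_gt0// ler_nat leq_fact//.
by rewrite -addnn (leq_trans (leq_addr k k)).
Qed.

Let term_le s z Z k : normc z <= Z -> normc (term s z k) <= majorant s Z k.
Proof.
move=> zZ; rewrite Normc.normcM normc_coeff normcX /majorant /exp_coeff /=.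
move: (s ^+ 2) (sqr_ge0 s) => q q0.
rewrite exprMn -!mulrA ler_wpM2l// ler_wpM2l ?exprn_ge0// mulrC.
rewrite ler_pM ?exprn_ge0 ?normc_ge0 ?invr_ge0//.
by rewrite lerXn2r// nnegrE ?normc_ge0// (le_trans (normc_ge0 z)).
Qed.

Lemma cvg_sin_sqrt_over_sqrt s z : series (term s z) @ \oo --> sin_sqrt_over_sqrt s z.
Proof.
apply: normc_summable_cvg.
apply: (series_le_cvg (v_ := majorant s (normc z))) => [k|k|k|].
- exact: normc_ge0.
- by rewrite mulr_ge0// exp_coeff_ge0// mulr_ge0 ?sqr_ge0 ?normc_ge0.
- exact: term_le.
- exact: cvgP (@cvg_majorant s (normc z)).
Qed.

Lemma normc_sin_sqrt_over_sqrt_le s z Z : normc z <= Z ->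
  normc (sin_sqrt_over_sqrt s z) <= `|s| * expR (s ^+ 2 * Z).
Proof.
move=> zZ; apply: (normc_series_le _ (@cvg_sin_sqrt_over_sqrt s z) (@cvg_majorant s Z)).
by move=> k; exact: term_le.
Qed.

(** Induction on [z^(k+1) - w^(k+1) = z (z^k - w^k) + w^k (z - w)]. With [1 <= Z] the natural power
    [Z^(k-1)] is rounded up to [Z^k], to match [majorant]. *)
Let normcXB z w Z k : 1 <= Z -> normc z <= Z -> normc w <= Z ->
  normc (z ^+ k - w ^+ k) <= k%:R * Z ^+ k * normc (z - w).
Proof.
move=> Z1 zZ wZ; have Z0 : 0 <= Z := le_trans ler01 Z1.
elim: k => [|k ih]; first by rewrite subrr Normc.normc0 !mul0r.
have -> : z ^+ k.+1 - w ^+ k.+1 = z * (z ^+ k - w ^+ k) + w ^+ k * (z - w).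
  by rewrite !exprS; ring.
apply: (le_trans (normcD _ _)); rewrite !Normc.normcM normcX.
have h1 : normc z * normc (z ^+ k - w ^+ k) <= Z * (k%:R * Z ^+ k * normc (z - w)).
  by rewrite ler_pM ?normc_ge0.
have h2 : normc w ^+ k * normc (z - w) <= Z ^+ k.+1 * normc (z - w).
  rewrite ler_wpM2r ?normc_ge0//; apply: (@le_trans _ _ (Z ^+ k)).
    by rewrite lerXn2r// nnegrE normc_ge0.
  by rewrite ler_weXn2l.
apply: le_trans (lerD h1 h2) _; rewrite le_eqVlt; apply/orP; left; apply/eqP.
by rewrite -[k.+1]addn1 natrD exprD expr1; ring.
Qed.

Lemma sin_sqrt_over_sqrt_lipschitz s z w Z : 1 <= Z -> normc z <= Z -> normc w <= Z ->
  normc (sin_sqrt_over_sqrt s z - sin_sqrt_over_sqrt s w) <=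
  `|s| * expR (s ^+ 2 * Z) * normc (z - w).
Proof.
move=> Z1 zZ wZ; have Z0 : 0 <= Z := le_trans ler01 Z1.
have h1 : series (term s z) - series (term s w) @ \oo -->
    sin_sqrt_over_sqrt s z - sin_sqrt_over_sqrt s w.
  by apply: cvgB; exact: cvg_sin_sqrt_over_sqrt.
have h2 : (series (majorant s Z) n * normc (z - w)) @[n --> \oo] -->
    `|s| * expR (s ^+ 2 * Z) * normc (z - w).
  by apply: cvgM; [exact: cvg_majorant|exact: cvg_cst].
have e1 : series (term s z) - series (term s w) = series (fun k => term s z k - term s w k).
  by apply/funext => n; rewrite -[LHS]/(series _ n - series _ n) /series /= -sumrB.
rewrite e1 in h1.
have h3 : series (fun k => majorant s Z k * normc (z - w)) @ \oo -->
    `|s| * expR (s ^+ 2 * Z) * normc (z - w).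
  by apply: cvg_eqfun h2 => n; rewrite /series /= mulr_suml.
apply: (normc_series_le _ h1 h3) => k.
rewrite /term -mulrBr Normc.normcM normc_coeff.
apply: le_trans (ler_wpM2l _ (normcXB k Z1 zZ wZ)) _.
  by rewrite divr_ge0// mulr_ge0// exprn_ge0// sqr_ge0.
rewrite mulrA ler_wpM2r ?normc_ge0// /majorant /exp_coeff /=.
move: (s ^+ 2) (sqr_ge0 s) => q q0; rewrite exprMn.
rewrite -!mulrA ler_wpM2l// ler_wpM2l ?exprn_ge0//.
by rewrite mulrCA mulrA mulrC ler_wpM2l ?exprn_ge0// coeff_le.
Qed.

Lemma cmeasurable_sin_sqrt_over_sqrt t z :
  cmeasurable (fun tau : R => sin_sqrt_over_sqrt (t - tau) z).
Proof.
have mp k : cmeasurable (fun tau : R => ((t - tau) ^+ k.*2.+1 / (k.*2.+1)`!%:R)%:C).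
  split=> /=; last exact: measurable_cst.
  by apply: measurable_funM => //; apply: measurable_funX; exact: measurable_funB.
apply: (cmeasurable_cvg (f := fun n (tau : R) => series (term (t - tau) z) n)) => [n|tau].
  have := cmeasurable_sum (fun k => (-1) ^+ k * z ^+ k) n mp.
  congr cmeasurable; apply/funext => tau; rewrite /series /=; apply: eq_bigr => k _.
  by rewrite /term mulrAC.
exact: cvg_sin_sqrt_over_sqrt.
Qed.

End sin_sqrt.

(** * Weak integrals *)

Section weak_integrals.
Context d (T : measurableType d) (R : realType) (mu : {measure set T -> \bar R}).
Local Notation H := (L2 mu).
Local Notation leb := (@lebesgue_measure R).
Variables (e : nat -> H).
Hypothesis he : hilbert_basis e.
Let e_ortho : forall i j, inner (e i) (e j) = (i == j)%:R := he.1.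

Lemma weak_integral_eq (D : set R) (F : R -> H) v : is_weak_integral D F v ->
  weak_integral D F = v.
Proof.
move=> hv; have hw := getPex (ex_intro _ _ hv : exists v, is_weak_integral D F v).
by apply: inner_ext => g; rewrite (hw g).2 (hv g).2.
Qed.

(** The integrated coefficients are square summable, so they define a vector [v]; it is tested first
    against finite combinations of the basis, then against any [g] by approximation. Measurability
    for general [g] comes from the coefficients through Parseval. *)
Lemma weak_integral_expansion (D : set R) (F : R -> H) (m B : R) :
  measurable D -> leb D = m%:E -> (forall t, D t -> L2norm (F t) <= B) ->
  (forall k, cmeasurable (fun t => inner (e k) (F t))) ->
  weakly_integrable D F /\
  series (fun k => cintegral leb D (fun t => inner (e k) (F t)) *: e k) @ \oo -->
    weak_integral D F.
Proof.
move=> mD lebD FB mF.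
have m0 : 0 <= m by rewrite -lee_fin -lebD measure_ge0.
have mFg g : cmeasurable (fun t => inner g (F t)).
  apply: (cmeasurable_cvg (f := fun n t =>
     series (fun k => (inner (e k) g)^*%C * inner (e k) (F t)) n)).
    by move=> n; rewrite /series /=; exact: cmeasurable_sum.
  by move=> t; exact: parseval.
have Fgb g t : D t -> normc (inner g (F t)) <= L2norm g * B.
  move=> /FB h; apply: le_trans (cauchy_schwarz _ _) _.
  by rewrite ler_wpM2l ?L2norm_ge0.
have iF g : cintegrable leb D (fun t => inner g (F t)).
  exact: (cintegrable_bounded (nu := leb) mD lebD (mFg g) (Fgb g)).
pose al k := cintegral leb D (fun t => inner (e k) (F t)).
have alE (a : nat -> R[i]) n :
    cintegral leb D (fun t => inner (\sum_(0 <= k < n) a k *: e k) (F t)) =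
    \sum_(0 <= k < n) (a k)^*%C * al k.
  rewrite -(cintegral_sum (nu := leb) mD lebD _ (B := fun k => L2norm (e k) * B)) => [|k|k t].
  - congr (cintegral _ _ _); apply/funext => t; rewrite inner_suml.
    by apply: eq_bigr => k _; rewrite innerZl.
  - exact: mFg.
  - exact: Fgb.
pose V n := \sum_(0 <= k < n) al k *: e k.
(* The square of the norm of [V n] is the integral of [inner (V n) (F t)], hence at most
   a constant times the norm itself. *)
have V2 n : L2norm (V n) ^+ 2 <= (2 * B * m) ^+ 2.
  have h : normc (cintegral leb D (fun t => inner (V n) (F t))) <= 2 * (L2norm (V n) * B) * m.
    exact: (normc_cintegral_le (nu := leb) mD lebD (mFg _) (Fgb _)).
  move: h; rewrite alE.
  have -> : \sum_(0 <= k < n) (al k)^*%C * al k = (L2norm (V n) ^+ 2)%:C.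
    rewrite L2norm_basis_sum// rmorph_sum; apply: eq_bigr => k _.
    exact: conj_mul_normc.
  rewrite normc_real ger0_norm ?sqr_ge0//.
  have := L2norm_ge0 (V n); set x := L2norm (V n) => x0 h.
  have [->|xn0] := eqVneq x 0; first by rewrite expr0n sqr_ge0.
  have xp : 0 < x by rewrite lt_def xn0.
  have : x <= 2 * B * m.
    rewrite -(ler_pM2l xp) -expr2; apply: le_trans h _.
    by rewrite le_eqVlt; apply/orP; left; apply/eqP; ring.
  by move=> hx; rewrite ler_sqr// nnegrE (le_trans x0).
have [v hv] : exists v : H, series (fun k => al k *: e k) @ \oo --> v.
  apply: basis_series_cvg => //.
  apply: (series_le_cvg_bound (M := (2 * B * m) ^+ 2)) => [k|n]; first by rewrite sqr_ge0.
  by rewrite -(L2norm_basis_sum e_ortho); exact: V2.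
have wv : is_weak_integral D F v.
  move=> g; split; first exact: iF.
  have h1 := parseval he (g := g) (h := v).
  apply: (cvg_unique (@norm_hausdorff _ R[i]) h1).
  apply/cvgCP.
  (* For the truncation [P n] of [g] sum and integral commute; the remaining error is at most a
     constant times the norm of [P n - g]. *)
  pose P n := \sum_(0 <= k < n) inner (e k) g *: e k.
  have hP : (2 * B * m) * L2norm (P n - g) @[n --> \oo] --> (0 : R).
    rewrite -(mulr0 (2 * B * m)); apply: cvgM; first exact: cvg_cst.
    by apply/L2cvgP; exact: basis_expansion.
  apply: (squeeze_cvgr _ (cvg_cst 0) hP); apply: nearW => n; rewrite normc_ge0/=.
  have -> : series (fun k => (inner (e k) g)^*%C * inner (e k) v) n =
      cintegral leb D (fun t => inner (P n) (F t)).
    rewrite alE /series /=; apply: eq_bigr => k _.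
    by rewrite (basis_series_coef he k hv).
  have -> : cintegral leb D (fun t => inner (P n) (F t)) -
      cintegral leb D (fun t => inner g (F t)) =
      cintegral leb D (fun t => inner (P n - g) (F t)).
    rewrite -cintegralB//; congr (cintegral _ _ _).
    by apply/funext => t; rewrite innerBl.
  apply: le_trans (normc_cintegral_le (nu := leb) mD lebD (mFg _) (Fgb _)) _.
  by rewrite le_eqVlt; apply/orP; left; apply/eqP; ring.
by rewrite (weak_integral_eq wv); split=> //; exists v.
Qed.

End weak_integrals.

(** * Continuous extensions *)

Section continuous_extensions.
Context (R : realType) (n : nat) (Omega : set 'rV[R]_n) (oOmega : open Omega).
Local Notation leb := (lebesgue_rV R n).
Local Notation mu := (lebesgue_on oOmega).
Local Notation H := (L2 mu).

(** The restricted measure does not charge the complement of [Omega], which may therefore be added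
    to an exceptional set. *)
Lemma ae_lebesgue_onP (P : 'rV[R]_n -> Prop) :
  {ae mu, forall x, P x} <-> {ae leb, forall x, Omega x -> P x}.
Proof.
have mO : measurable Omega := open_measurable_rV oOmega.
split=> -[N [mN N0 sN]].
  exists (N `&` Omega); split; first exact: measurableI.
    exact: N0.
  move=> x /= nP; have [Ox nPx] := (not_implyP _ _).1 nP.
  by split=> //; apply: sN.
exists (N `|` ~` Omega); split; first by apply: measurableU => //; exact: measurableC.
  have -> : mu (N `|` ~` Omega) = leb ((N `|` ~` Omega) `&` Omega) by [].
  rewrite setIUl setICl setU0.
  have := @subset_measure0 _ _ _ leb _ _ (measurableI _ _ mN mO) mN (@subIsetl _ N Omega) N0.
  exact.
move=> x /= nP; have [Ox|nO] := pselect (Omega x); [left|by right].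
by apply: sN => /= /(_ Ox).
Qed.

Variables (e : nat -> H) (Omega_hat : set 'rV[R]_n) (e_hat : nat -> 'rV[R]_n -> R[i]) (K : R).
Hypothesis oOmega_hat : open Omega_hat.
Hypothesis closure_Omega : closure Omega `<=` Omega_hat.
Hypothesis e_hat_cont : forall k, {within Omega_hat, continuous (e_hat k)}.
Hypothesis e_hat_le : forall k x, Omega_hat x -> normc (e_hat k x) <= K.
Hypothesis e_hatE : forall k, L2_fun (e k) = e_hat k %[ae leb in Omega].

Let e_hat_cvg k x : Omega_hat x -> e_hat k y @[y --> x] --> e_hat k x.
Proof.
move=> Ox; have := @e_hat_cont k; rewrite continuous_open_subspace// => /(_ x).
by apply; exact: mem_set.
Qed.

Section extension.
Variable a : nat -> R[i].
Hypothesis a_summable : cvgn (series (fun k => normc (a k))).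

(** Meaningful on [Omega_hat] only, where the series converges; nothing is claimed about it
    elsewhere. *)
Let phi x := limn (series (fun k => a k * e_hat k x)).

Let K0 x : Omega_hat x -> 0 <= K.
Proof. by move=> Ox; exact: le_trans (normc_ge0 _) (e_hat_le 0 Ox). Qed.

Let term_le k x : Omega_hat x -> normc (a k * e_hat k x) <= K * normc (a k).
Proof.
by move=> Ox; rewrite Normc.normcM mulrC ler_wpM2r ?normc_ge0 ?e_hat_le.
Qed.

Let phi_cvg x : Omega_hat x -> series (fun k => a k * e_hat k x) @ \oo --> phi x.
Proof.
move=> Ox; apply: normc_summable_cvg.
apply: (series_le_cvg (v_ := fun k => K * normc (a k))) => [k|k|k|].
- exact: normc_ge0.
- by rewrite mulr_ge0 ?normc_ge0// (K0 Ox).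
- exact: term_le.
have h : (K * series (fun k => normc (a k)) n) @[n --> \oo] -->
    K * limn (series (fun k => normc (a k))).
  by apply: cvgM; [exact: cvg_cst|exact: a_summable].
apply: cvgP; apply: cvg_eqfun h => N.
by rewrite /series /= mulr_sumr.
Qed.

Let tail N := K * (limn (series (fun k => normc (a k))) - series (fun k => normc (a k)) N).

Let tail_cvg0 : tail @ \oo --> (0 : R).
Proof.
rewrite -(mulr0 K) -(subrr (limn (series (fun k => normc (a k))))).
by apply: cvgM; [exact: cvg_cst|apply: cvgB; [exact: cvg_cst|exact: a_summable]].
Qed.

Let phi_tail N x : Omega_hat x ->
  normc (phi x - series (fun k => a k * e_hat k x) N) <= tail N.
Proof.
move=> Ox.
have h : normc (series (fun k => a k * e_hat k x) m - series (fun k => a k * e_hat k x) N)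
    @[m --> \oo] --> normc (phi x - series (fun k => a k * e_hat k x) N).
  by apply: cvg_normc; apply: cvgB; [exact: phi_cvg|exact: cvg_cst].
apply: (ler_cvg_to h (cvg_cst (tail N))); exists N => // m /= Nm.
rewrite sub_series_geq//; apply: le_trans (normc_sum _ _ _) _.
apply: (@le_trans _ _ (\sum_(N <= k < m) K * normc (a k))).
  by apply: ler_sum => k _; exact: term_le.
rewrite -mulr_sumr ler_wpM2l ?(K0 Ox)// -sub_series_geq// lerD2r.
by apply: series_nneg_le_lim => // k; exact: normc_ge0.
Qed.

(** An [eps / 3] argument with the tail bound that is uniform in [x]. As [Omega_hat] is open, the
    limit is over full neighbourhoods, so limits along [closure Omega] and [Omega] follow by
    restriction. *)
Let phi_continuous x : Omega_hat x -> phi y @[y --> x] --> phi x.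
Proof.
move=> Ox; apply/(cvgCP (F := nbhs x))/(cvgrPdist_le (F := nbhs x)) => eps eps0.
have e3 : 0 < eps / 3 by rewrite divr_gt0.
have /cvgrPdist_le/(_ _ e3)[N _ /(_ N (leqnn N))] := tail_cvg0.
rewrite sub0r normrN => /(le_trans (ler_norm _)) tN.
have SN : series (fun k => a k * e_hat k y) N @[y --> x] --> series (fun k => a k * e_hat k x) N.
  apply: (cvg_linear_combination (F := nbhs x)) => k; exact: e_hat_cvg.
have /(cvgCP (F := nbhs x))/(cvgrPdist_le (F := nbhs x))/(_ _ e3) := SN.
have Oy : \forall y \near x, Omega_hat y by exact: open_nbhs_nbhs.
apply: filterS2 Oy => y Oy; rewrite !sub0r !normrN !ger0_norm ?normc_ge0// => Sy.
have -> : phi y - phi x = (phi y - series (fun k => a k * e_hat k y) N) +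
    (series (fun k => a k * e_hat k y) N - series (fun k => a k * e_hat k x) N) +
    (series (fun k => a k * e_hat k x) N - phi x) by ring.
apply: le_trans (normcD _ _) _; rewrite [X in _ + X <= _]normcBC.
have h1 := le_trans (phi_tail N Oy) tN; have h2 := le_trans (phi_tail N Ox) tN.
have h3 := normcD (phi y - series (fun k => a k * e_hat k y) N)
  (series (fun k => a k * e_hat k y) N - series (fun k => a k * e_hat k x) N).
rewrite (_ : eps = eps / 3 + eps / 3 + eps / 3); last by field.
by apply: lerD h2; apply: le_trans h3 _; exact: lerD.
Qed.

Lemma basis_series_continuous_extension (w : H) :
  series (fun k => a k *: e k) @ \oo --> w ->
  exists2 phi : 'rV[R]_n -> R[i], continuous_extension w phi &
    forall x, limit_point Omega x ->
      exists (s : R[i]) (l : nat -> R[i]),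
        [/\ forall k, e_hat k y @[y --> within Omega x^'] --> l k,
            phi y @[y --> within Omega x^'] --> s &
            series (fun k => a k * l k) @ \oo --> s].
Proof.
move=> hw; exists phi; last first.
  (* A limit point of [Omega] lies in its closure, hence in [Omega_hat], where the limits are the
     values themselves. *)
  move=> x lx; exists (phi x), (fun k => e_hat k x).
  have Ox : Omega_hat x.
    apply: closure_Omega => B /lx[y [_ Oy By]]; by exists y.
  have sub (g : 'rV[R]_n -> R[i]) l : g y @[y --> x] --> l ->
      g y @[y --> within Omega x^'] --> l.
    apply: cvg_trans; apply: cvg_app; apply: (cvg_trans (@cvg_within _ _ _ _)).
    exact: cvg_within.
  split=> [k||]; [exact/sub/e_hat_cvg|exact/sub/phi_continuous|exact: phi_cvg].
split.
  apply: continuous_in_subspaceT => x /set_mem/closure_Omega; exact: phi_continuous.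
suff : L2_fun w = phi %[ae mu in setT].
  by move=> h; apply/ae_lebesgue_onP; apply: filterS h => x /(_ I).
apply: (cvg_ae_unique hw).
(* A single exceptional set serves all indices, since there are countably many of them. *)
have h1 : {ae mu, forall x, forall k, e k x = e_hat k x}.
  apply: ae_foralln => k; exact/ae_lebesgue_onP.
have h2 : {ae mu, forall x, forall N, (series (fun k => a k *: e k) N : H) x =
    \sum_(0 <= k < N) a k * e k x}.
  apply: ae_foralln; elim=> [|N ih].
    have := L2_funZ 0 (0 : H); rewrite scale0r; apply: filterS => x /(_ I).
    by rewrite /series /= !big_geq// mul0r.
  apply: filterS3 ih (L2_funD (series (fun k => a k *: e k) N) (a N *: e N)) (L2_funZ (a N) (e N)).
  by move=> x ih /(_ I) hD /(_ I) hZ; rewrite seriesSr hD ih hZ big_nat_recr.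
have h3 : {ae mu, forall x, Omega x} by apply/ae_lebesgue_onP; exact: aeW.
apply: filterS3 h1 h2 h3 => x h1 h2 Ox.
apply: cvg_eqfun (phi_cvg (closure_Omega (subset_closure Ox))) => N.
by rewrite h2 /series /=; apply: eq_bigr => k _; rewrite h1.
Qed.

End extension.
End continuous_extensions.

(** * Hilbert-Schmidt norms and symmetry of diagonal operators *)

Section hilbert_schmidt_diagonal.
Context d (T : measurableType d) (R : realType) (mu : {measure set T -> \bar R}).
Local Notation H := (L2 mu).
Variable e : nat -> H.
Hypothesis he : hilbert_basis e.

Lemma cvgn_series_normr_sqr (V : normedModType R[i]) (N : V -> R) (u : nat -> V) :
  (forall v, `|v| = (N v)%:C) ->
  cvgn (series (fun k => `|u k| ^+ 2)) <-> cvgn (series (fun k => N (u k) ^+ 2)).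
Proof.
move=> NE; rewrite -cvgn_real.
have -> : series (fun k => `|u k| ^+ 2) = fun n => (series (fun k => N (u k) ^+ 2) n)%:C.
  apply/funext => n; rewrite -series_real /series /=; apply: eq_bigr => k _.
  by rewrite NE rmorphXn.
by [].
Qed.

(** One direction takes [e] as the witness basis. In the other the basis [g] is arbitrary: [|m j|^2]
    is spread over [g] by Parseval for [e j], the two sums are exchanged, and Bessel bounds each
    inner sum by the squared norm of [diag e m (g k)]. *)
Lemma hilbert_schmidt_diag (m : nat -> R[i]) (M : R) : (forall k, normc (m k) <= M) ->
  hilbert_schmidt (diag e m) <-> cvgn (series (fun k => normc (m k) ^+ 2)).
Proof.
move=> mM; split=> [[_ [g hg]]|hm]; last first.
  split; first exact: (bounded_diag he mM).
  exists e => //; apply/(cvgn_series_normr_sqr _ (@L2_normE _ _ _ _)).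
  have E k : L2norm (diag e m (e k)) = normc (m k).
    by rewrite (diag_basis he k mM) L2normZ /L2norm he.1 eqxx /= sqrtr1 mulr1.
  by under eq_fun do rewrite E.
move=> /(cvgn_series_normr_sqr _ (@L2_normE _ _ _ _)).
set S := series _ => cS.
apply: (series_le_cvg_bound (M := limn S)) => [k|N]; first exact: sqr_ge0.
have key : (fun n => \sum_(0 <= j < N) normc (m j) ^+ 2 *
      series (fun k => normc (inner (g k) (e j)) ^+ 2) n) @ \oo -->
    \sum_(0 <= j < N) normc (m j) ^+ 2.
  elim: N => [|N ih].
    apply: (cvg_eqfun (u := fun=> 0)); last by rewrite big_geq//; exact: cvg_cst.
    by move=> n; rewrite big_geq.
  rewrite big_nat_recr//=.
  apply: (cvg_eqfun (u := fun n => \sum_(0 <= j < N) normc (m j) ^+ 2 *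
      series (fun k => normc (inner (g k) (e j)) ^+ 2) n +
      normc (m N) ^+ 2 * series (fun k => normc (inner (g k) (e N)) ^+ 2) n)).
    by move=> n; rewrite big_nat_recr.
  apply: cvgD; first exact: ih.
  rewrite -[X in _ --> X]mulr1; apply: cvgM; first exact: cvg_cst.
  have -> : 1 = L2norm (e N) ^+ 2 by rewrite /L2norm he.1 eqxx /= sqrtr1 expr1n.
  exact: (parseval_norm hg (h := e N)).
apply: (ler_cvg_to key cS); apply: nearW => n.
rewrite /S /series /=.
under eq_bigr do rewrite mulr_sumr.
rewrite exchange_big /=; apply: ler_sum => k _.
apply: le_trans (bessel he.1 (diag e m (g k)) N); apply: ler_sum => j _.
by rewrite (inner_basis_diag he mM) Normc.normcM exprMn (inner_conj (e j)) normc_conj.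
Qed.

Lemma diag_sym (m : nat -> R[i]) (M : R) g h : (forall k, normc (m k) <= M) ->
  (forall k, (m k)^*%C = m k) -> inner g (diag e m h) = inner (diag e m g) h.
Proof.
move=> mM mr.
have h1 := parseval he (g := g) (h := diag e m h).
have h2 := parseval he (g := diag e m g) (h := h).
apply: (cvg_unique (@norm_hausdorff _ R[i]) h1); apply: cvg_eqfun h2 => n.
rewrite /series /=; apply: eq_bigr => k _; rewrite !(inner_basis_diag he mM) rmorphM /= mr.
by rewrite mulrCA mulrA.
Qed.

End hilbert_schmidt_diagonal.

(** * Products of square summable sequences, and time intervals *)

Section square_summable.
Context (R : realType).

Lemma sum_mul_le_sqr (x y : nat -> R) n (X Y : R) : (forall k, 0 <= x k) -> (forall k, 0 <= y k) ->
  \sum_(0 <= k < n) x k ^+ 2 <= X -> \sum_(0 <= k < n) y k ^+ 2 <= Y ->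
  \sum_(0 <= k < n) x k * y k <= X + Y.
Proof.
move=> x0 y0 hX hY; apply: le_trans (lerD hX hY); rewrite -big_split /=.
by apply: ler_sum => k _; have := x0 k; have := y0 k; nra.
Qed.

Lemma time_interval_bound (t tau : R) : time_interval t tau -> `|t - tau| <= `|t|.
Proof.
rewrite /time_interval; case: ifPn => [t0|]; rewrite /= in_itv /=.
  move=> /andP[h1 h2]; rewrite ger0_norm ?subr_ge0// ger0_norm//; lra.
rewrite -ltNge => t0 /andP[h1 h2]; rewrite ler0_norm ?subr_le0// (ler0_norm (ltW t0)); lra.
Qed.

Lemma measurable_time_interval (t : R) : measurable (time_interval t).
Proof. by rewrite /time_interval; case: ifP => _; exact: measurable_itv. Qed.

Lemma lebesgue_time_interval (t : R) :
  (@lebesgue_measure R) (time_interval t) = `|t|%:E.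
Proof.
rewrite /time_interval; case: ifPn => [t0|]; rewrite lebesgue_measure_itv /= lte_fin.
  rewrite ger0_norm//; case: ifPn => [_|]; first by rewrite -EFinB subr0.
  by rewrite -leNgt => h; congr (_%:E); apply/eqP; rewrite eq_le h t0.
by rewrite -ltNge => t0; rewrite t0 -EFinB sub0r ltr0_norm.
Qed.

End square_summable.

(** * Weak integrals with the sine kernel *)

Section wave_integrals.
Context d (T : measurableType d) (R : realType) (mu : {measure set T -> \bar R}).
Local Notation H := (L2 mu).
Local Notation leb := (@lebesgue_measure R).
Variables (e : nat -> H) (b : R -> H).
Hypothesis he : hilbert_basis e.
Hypothesis b_cont : continuous b.

Lemma bounded_on_time_interval (t : R) :
  exists B, forall tau, time_interval t tau -> L2norm (b tau) <= B.
Proof.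
have cb : continuous (fun tau => L2norm (b tau)).
  by move=> tau; apply: cvg_L2norm; exact: b_cont.
rewrite /time_interval; case: ifPn => [t0|].
  have [|x _ hx] := @EVT_max R (fun tau => L2norm (b tau)) 0 t t0.
    exact: continuous_subspaceT.
  by exists (L2norm (b x)) => tau /= /hx.
rewrite -ltNge => /ltW t0.
have [|x _ hx] := @EVT_max R (fun tau => L2norm (b tau)) t 0 t0.
  exact: continuous_subspaceT.
by exists (L2norm (b x)) => tau /= /hx.
Qed.

Lemma cmeasurable_inner_continuous g : cmeasurable (fun tau : R => inner g (b tau)).
Proof.
split; apply: continuous_measurable_fun => tau.
  by apply: cvg_Re; apply: cvg_innerr; exact: b_cont.
by apply: cvg_Im; apply: cvg_innerr; exact: b_cont.
Qed.

Lemma sin_sqrt_bound_on_time_interval (t tau Z : R) (z : R[i]) :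
  time_interval t tau -> normc z <= Z ->
  normc (sin_sqrt_over_sqrt (t - tau) z) <= `|t| * expR (t ^+ 2 * Z).
Proof.
move=> /time_interval_bound tt zZ; have Z0 := le_trans (normc_ge0 z) zZ.
apply: le_trans (normc_sin_sqrt_over_sqrt_le _ zZ) _.
rewrite ler_pM ?expR_ge0// ler_expR ler_wpM2r//.
by rewrite -(real_normK (num_real (t - tau))) -(real_normK (num_real t)) lerXn2r ?nnegrE.
Qed.

Section kernel.
Variables (z : nat -> R[i]) (Z t : R).
Hypothesis zZ : forall k, normc (z k) <= Z.

Let g k (tau : R) := sin_sqrt_over_sqrt (t - tau) (z k) * inner (e k) (b tau).

Let mg k : cmeasurable (g k).
Proof.
apply: cmeasurableM; first exact: cmeasurable_sin_sqrt_over_sqrt.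
exact: cmeasurable_inner_continuous.
Qed.

(** Phrased through the coefficients of [F], so that it covers both [v], with
    [z k = c - f(lambda k)], and [vc], with [z] constant. *)
Lemma weak_integral_sin_sqrt (F : R -> H) :
  (forall tau k, inner (e k) (F tau) = sin_sqrt_over_sqrt (t - tau) (z k) * inner (e k) (b tau)) ->
  weakly_integrable (time_interval t) F /\
  series (fun k => cintegral leb (time_interval t) (fun tau =>
      sin_sqrt_over_sqrt (t - tau) (z k) * inner (e k) (b tau)) *: e k) @ \oo -->
    weak_integral (time_interval t) F.
Proof.
move=> FE; have [B bB] := bounded_on_time_interval t.
pose m tau k := sin_sqrt_over_sqrt (t - tau) (z k).
have mb tau k : normc (m tau k) <= `|t - tau| * expR ((t - tau) ^+ 2 * Z).
  exact: normc_sin_sqrt_over_sqrt_le.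
have FD tau : F tau = diag e (m tau) (b tau).
  by apply: (basis_ext he) => k; rewrite FE (inner_basis_diag he (mb tau)).
have FB tau : time_interval t tau -> L2norm (F tau) <= `|t| * expR (t ^+ 2 * Z) * B.
  move=> tt; rewrite FD.
  have mt k : normc (m tau k) <= `|t| * expR (t ^+ 2 * Z) by exact: sin_sqrt_bound_on_time_interval.
  apply: le_trans (L2norm_diag he mt (b tau)) _.
  by rewrite ler_wpM2l ?bB// mulr_ge0 ?expR_ge0.
have mF k : cmeasurable (fun tau : R => inner (e k) (F tau)).
  by under eq_fun do rewrite FE; exact: mg.
have := weak_integral_expansion he (measurable_time_interval t) (lebesgue_time_interval t) FB mF.
have FEk k : (fun tau => inner (e k) (F tau)) = g k by apply/funext => tau; exact: FE.
by under eq_fun do rewrite FEk.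
Qed.

Lemma cintegrable_sin_sqrt k :
  cintegrable leb (time_interval t)
    (fun tau => sin_sqrt_over_sqrt (t - tau) (z k) * inner (e k) (b tau)).
Proof.
have [B bB] := bounded_on_time_interval t.
apply: (cintegrable_bounded (nu := leb) (B := `|t| * expR (t ^+ 2 * Z) * B)
  (measurable_time_interval t) (lebesgue_time_interval t) (mg k)) => tau tt.
rewrite Normc.normcM ler_pM ?normc_ge0//; first exact: sin_sqrt_bound_on_time_interval.
exact: le_trans (normc_inner_basis he.1 _ _) (bB _ tt).
Qed.

End kernel.

Lemma cintegral_sin_sqrt_difference (z w : R[i]) (t : R) k :
  cintegral leb (time_interval t) (fun tau =>
    (sin_sqrt_over_sqrt (t - tau) z - sin_sqrt_over_sqrt (t - tau) w) * inner (e k) (b tau)) =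
  cintegral leb (time_interval t) (fun tau =>
    sin_sqrt_over_sqrt (t - tau) z * inner (e k) (b tau)) -
  cintegral leb (time_interval t) (fun tau =>
    sin_sqrt_over_sqrt (t - tau) w * inner (e k) (b tau)).
Proof.
have iz x := @cintegrable_sin_sqrt (fun=> x) (normc x) t (fun=> lexx _) k.
rewrite -(cintegralB (nu := leb) (measurable_time_interval t) (iz z) (iz w)).
by congr (cintegral _ _ _); apply/funext => tau; rewrite mulrBl.
Qed.

(** At fixed [tau] the Lipschitz bound leaves the sum of [|z k - w| |inner (e k) (b tau)|], which
    [x y <= x^2 + y^2] and Bessel bound independently of the number of terms and of [tau]. *)
Lemma summable_sin_sqrt_difference (z : nat -> R[i]) (w : R[i]) (Z t : R) :
  (forall k, normc (z k) <= Z) -> normc w <= Z ->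
  cvgn (series (fun k => normc (z k - w) ^+ 2)) ->
  cvgn (series (fun k => normc (cintegral leb (time_interval t) (fun tau =>
    (sin_sqrt_over_sqrt (t - tau) (z k) - sin_sqrt_over_sqrt (t - tau) w) *
    inner (e k) (b tau))))).
Proof.
move=> zZ wZ zw; have [B bB] := bounded_on_time_interval t.
set I := time_interval t.
pose g k (tau : R) := (sin_sqrt_over_sqrt (t - tau) (z k) - sin_sqrt_over_sqrt (t - tau) w) *
  inner (e k) (b tau).
pose be k := cintegral leb I (g k).
(* The Lipschitz estimate asks for a radius of at least 1, hence [Z + 1]. *)
pose L := `|t| * expR (t ^+ 2 * (Z + 1)).
have L0 : 0 <= L by rewrite mulr_ge0 ?expR_ge0.
have Z0 : 0 <= Z := le_trans (normc_ge0 _) wZ.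
have lip k tau : I tau -> normc (sin_sqrt_over_sqrt (t - tau) (z k) -
    sin_sqrt_over_sqrt (t - tau) w) <= L * normc (z k - w).
  move=> /time_interval_bound tt.
  apply: le_trans (@sin_sqrt_over_sqrt_lipschitz _ _ _ _ (Z + 1) _ _ _) _.
  - by rewrite lerDr.
  - by rewrite (le_trans (zZ k))// lerDl.
  - by rewrite (le_trans wZ)// lerDl.
  rewrite ler_wpM2r ?normc_ge0// ler_pM ?expR_ge0// ler_expR ler_wpM2r ?addr_ge0//.
  by rewrite -(real_normK (num_real (t - tau))) -(real_normK (num_real t)) lerXn2r ?nnegrE.
have mg k : cmeasurable (g k).
  apply: cmeasurableM; last exact: cmeasurable_inner_continuous.
  by apply: cmeasurableB; exact: cmeasurable_sin_sqrt_over_sqrt.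
have gk k tau : I tau -> normc (g k tau) <= L * (normc (z k - w) * normc (inner (e k) (b tau))).
  by move=> It; rewrite Normc.normcM mulrA ler_wpM2r ?normc_ge0 ?lip.
have gB k tau : I tau -> normc (g k tau) <= L * (normc (z k - w) * B).
  move=> It; apply: le_trans (gk k tau It) _; rewrite ler_wpM2l// ler_wpM2l ?normc_ge0//.
  exact: le_trans (normc_inner_basis he.1 _ _) (bB _ It).
(* Multiplying by the phases sg k moves the absolute values inside the integral. *)
pose sg k := (be k)^*%C * (normc (be k))^-1%:C.
have sgbe k : sg k * be k = (normc (be k))%:C.
  rewrite /sg mulrAC conj_mul_normc -rmorphM /=.
  have [->|n0] := eqVneq (normc (be k)) 0; first by rewrite invr0 mulr0.
  by rewrite expr2 mulfK.
have sg1 k : normc (sg k) <= 1.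
  rewrite Normc.normcM normc_conj normc_real ger0_norm ?invr_ge0 ?normc_ge0//.
  have [->|n0] := eqVneq (normc (be k)) 0; first by rewrite invr0 mulr0.
  by rewrite mulfV.
pose X := limn (series (fun k => normc (z k - w) ^+ 2)).
apply: (series_le_cvg_bound (M := 2 * (L * (X + B ^+ 2)) * `|t|)) => [k|N]; first exact: normc_ge0.
have sumE : (\sum_(0 <= k < N) normc (be k))%:C = \sum_(0 <= k < N) sg k * be k.
  by rewrite rmorph_sum; apply: eq_bigr => k _; rewrite sgbe.
rewrite -[leLHS]/(\sum_(0 <= k < N) normc (be k)).
rewrite -[leLHS]ger0_norm; last by apply: sumr_ge0 => k _; exact: normc_ge0.
rewrite -(normc_real (\sum_(0 <= k < N) normc (be k))) sumE.
rewrite -(cintegral_sum (nu := leb) (measurable_time_interval t) (lebesgue_time_interval t)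
  sg N mg gB).
apply: (normc_cintegral_le (nu := leb) (measurable_time_interval t) (lebesgue_time_interval t)).
  exact: cmeasurable_sum.
move=> tau It; apply: le_trans (normc_sum _ _ _) _.
apply: (@le_trans _ _ (\sum_(0 <= k < N) L * (normc (z k - w) * normc (inner (e k) (b tau))))).
  apply: ler_sum => k _; rewrite Normc.normcM -[leRHS]mul1r ler_pM ?normc_ge0//.
  exact: gk.
rewrite -mulr_sumr ler_wpM2l//; apply: sum_mul_le_sqr.
- by move=> k; exact: normc_ge0.
- by move=> k; exact: normc_ge0.
- by apply: series_nneg_le_lim => // k; exact: sqr_ge0.
- apply: le_trans (bessel he.1 _ _) _.
  by rewrite ler_sqr ?nnegrE ?L2norm_ge0 ?bB// (le_trans (L2norm_ge0 _) (bB _ It)).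
Qed.

End wave_integrals.

Theorem theorem23 (R : realType) (c K : R) (n : nat)
  (Omega : set 'rV[R]_n) (oOmega : open Omega)
  (A : operator (lebesgue_on oOmega))
  (e : nat -> L2 (lebesgue_on oOmega)) (lambda : nat -> R)
  (Omega_hat : set 'rV[R]_n) (e_hat : nat -> 'rV[R]_n -> R[i])
  (f : R -> R[i]) (u : L2 (lebesgue_on oOmega))
  (b : R -> L2 (lebesgue_on oOmega)) :
  0 < c -> 0 < K -> (0 < n)%N ->
  Omega !=set0 -> bounded_set Omega ->
  linear_operator A -> densely_defined A -> self_adjoint A ->
  hilbert_basis e ->
  (forall k, dom A (e k) /\ A (e k) = (lambda k)%:C *: e k) ->
  open Omega_hat -> bounded_set Omega_hat -> closure Omega `<=` Omega_hat ->
  (forall k, {within Omega_hat, continuous (e_hat k)}) ->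
  (forall k x, Omega_hat x -> `|e_hat k x| <= K%:C) ->
  (forall k, L2_fun (e k) = e_hat k %[ae lebesgue_rV R n in Omega]) ->
  (exists M : R, forall x, spectrum A x -> `|f x| <= M%:C) ->
  universally_measurable (spectrum A) f ->
  continuous b ->
  let fA := functional_calculus A f in
  [/\ (* (i) *)
      hilbert_schmidt fA <->
        cvgn (series (fun k => `|f (lambda k)| ^+ 2)),
      (* (ii) *)
      hilbert_schmidt fA ->
        exists2 phi : 'rV[R]_n -> R[i], continuous_extension (fA u) phi &
          forall x, limit_point Omega x ->
            exists (s : R[i]) (l : nat -> R[i]),
              [/\ forall k, e_hat k y @[y --> within Omega x^'] --> l k,
                  phi y @[y --> within Omega x^'] --> s &
                  series (fun k => f (lambda k) * inner (e k) u * l k) @ \oo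
                    --> s] &
      (* (iii) *)
      (forall x, spectrum A x -> f x \is Num.real) ->
      hilbert_schmidt fA ->
      (forall h, inner h (fA h) <= c%:C * `|h| ^+ 2) ->
      let cA := everywhere (fun h => c%:C *: h - fA h) in
      let F t tau := functional_calculus cA
        (fun x => sin_sqrt_over_sqrt (t - tau) x%:C) (b tau) in
      let Fc t tau := sin_sqrt_over_sqrt (t - tau) c%:C *: b tau in
      let v t := weak_integral (time_interval t) (F t) in
      let vc t := weak_integral (time_interval t) (Fc t) in
      (* a) *)
      (forall t, weakly_integrable (time_interval t) (F t) /\
        series (fun k =>
          cintegral (@lebesgue_measure R) (time_interval t) (fun tau =>
            sin_sqrt_over_sqrt (t - tau) (c%:C - f (lambda k)) *
            inner (e k) (b tau)) *: e k) @ \oo --> v t) /\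
      (* b) *)
      (forall t, weakly_integrable (time_interval t) (Fc t) /\
        exists2 phi : 'rV[R]_n -> R[i], continuous_extension (v t - vc t) phi &
          forall x, limit_point Omega x ->
            exists (s : R[i]) (l : nat -> R[i]),
              [/\ forall k, e_hat k y @[y --> within Omega x^'] --> l k,
                  phi y @[y --> within Omega x^'] --> s &
                  series (fun k =>
                    cintegral (@lebesgue_measure R) (time_interval t)
                      (fun tau =>
                        (sin_sqrt_over_sqrt (t - tau) (c%:C - f (lambda k)) -
                         sin_sqrt_over_sqrt (t - tau) c%:C) *
                        inner (e k) (b tau)) * l k) @ \oo --> s])].
Proof.
move=> c0 K0 _ _ _ A_lin _ A_sa he A_eig oOmega_hat _ clO e_hat_cont e_hat_le e_hatE.
move=> [M fM] _ b_cont fA.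
have e_hat_leK k x : Omega_hat x -> normc (e_hat k x) <= K.
  by move=> /(e_hat_le k); rewrite normC lecR.
have spec k := eigenvalue_in_spectrum he A_eig k.
have flM k : normc (f (lambda k)) <= M by have := fM _ (spec k); rewrite normC lecR.
have fAE : fA = diag e (f \o lambda) := functional_calculus_diag A_lin A_sa he A_eig flM.
have HS : hilbert_schmidt fA <-> cvgn (series (fun k => normc (f (lambda k)) ^+ 2)).
  by rewrite fAE; exact: (hilbert_schmidt_diag he flM).
split.
- apply: (iff_trans HS); apply: iff_sym.
  exact: (cvgn_series_normr_sqr (fun k => f (lambda k)) (@normC R)).
- move=> /HS hs; rewrite fAE.
  apply: (basis_series_continuous_extension oOmega_hat clO e_hat_cont e_hat_leK e_hatE).
    apply: (series_le_cvg_bound (M := limn (series (fun k => normc (f (lambda k)) ^+ 2)) +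
      L2norm u ^+ 2)) => [k|N]; first exact: normc_ge0.
    under eq_bigr do rewrite Normc.normcM.
    apply: sum_mul_le_sqr => [k|k||]; [exact: normc_ge0|exact: normc_ge0| |exact: (bessel he.1)].
    by apply: series_nneg_le_lim => // k; exact: sqr_ge0.
  exact: (diag_series he flM).
move=> f_real /HS hs _ cA F Fc v vc.
(* The diagonalization lemma takes real eigenvalues, while [f] is complex-valued; on the spectrum
   [f] is real, so [Re] loses nothing there. *)
pose lam' k := c - Re (f (lambda k)).
have fl_real k : f (lambda k) = (Re (f (lambda k)))%:C.
  have := f_real _ (spec k); rewrite realE; case: (f (lambda k)) => x y.
  by rewrite !lecE /= => /orP[/andP[/eqP + _]|/andP[/eqP + _]] => [->|<-].
have lam'E k : (lam' k)%:C = c%:C - f (lambda k) by rewrite rmorphB /= -fl_real.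
(* One radius for all arguments of the kernel; [c] itself lies within it too. *)
have cM k : normc (c%:C - f (lambda k)) <= c + M.
  by apply: le_trans (normcD _ _) _; rewrite normcNl normc_real ger0_norm ?lerD2l ?(ltW c0).
have cAE h : cA h = diag e (fun k => c%:C - f (lambda k)) h.
  rewrite /cA /= fAE; apply: (basis_ext he) => k.
  rewrite innerBr innerZr (inner_basis_diag he (m := f \o lambda) flM).
  by rewrite (inner_basis_diag he cM) mulrBl.
have cA_lin : linear_operator cA.
  by split=> // a g h _ _; split=> //; rewrite !cAE (diag_linear he cM).
have cA_sym g h : inner g (cA h) = inner (cA g) h.
  rewrite !cAE (diag_sym he _ _ cM)// => k.
  by rewrite -lam'E /conjc /= oppr0.
have cA_sa : self_adjoint cA.
  (* Testing the adjoint relation on the basis vectors, all in the domain, determines the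
     coefficients of [w] and forces [w = cA g]. *)
  move=> g w; split=> [gw|[_ <-] h _]; last exact: cA_sym.
  split=> //; apply/esym; apply: (basis_ext he) => k.
  by rewrite inner_conj -gw// cA_sym -inner_conj.
have cA_eig k : dom cA (e k) /\ cA (e k) = (lam' k)%:C *: e k.
  by split=> //; rewrite cAE (diag_basis he k cM) lam'E.
have FE t tau k : inner (e k) (F t tau) =
    sin_sqrt_over_sqrt (t - tau) (c%:C - f (lambda k)) * inner (e k) (b tau).
  have bnd j : normc (sin_sqrt_over_sqrt (t - tau) (lam' j)%:C) <=
      `|t - tau| * expR ((t - tau) ^+ 2 * (c + M)).
    by apply: normc_sin_sqrt_over_sqrt_le; rewrite lam'E.
  rewrite /F (functional_calculus_diag cA_lin cA_sa he cA_eig (M := _) bnd).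
  by rewrite (inner_basis_diag he bnd) /= lam'E.
have FcE t tau k : inner (e k) (Fc t tau) =
    sin_sqrt_over_sqrt (t - tau) c%:C * inner (e k) (b tau) by rewrite /Fc innerZr.
have cZ : normc (c%:C : R[i]) <= c + M.
  by rewrite normc_real ger0_norm ?(ltW c0)// lerDl (le_trans (normc_ge0 _) (flM 0%N)).
have hv t := weak_integral_sin_sqrt he b_cont cM (FE t).
have hvc t := weak_integral_sin_sqrt he b_cont (fun=> cZ) (FcE t).
split=> t; first exact: hv.
split; first exact: (hvc t).1.
apply: (basis_series_continuous_extension oOmega_hat clO e_hat_cont e_hat_leK e_hatE).
  apply: (summable_sin_sqrt_difference he b_cont cM cZ).
  (* Here [z k - w] is [- f (lambda k)], so the required square summability is the Hilbert-Schmidt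
     condition. *)
  under eq_fun do rewrite addrAC subrr add0r normcNl.
  exact: hs.
apply: (cvg_eqfun _ (cvgB (hv t).2 (hvc t).2)) => N.
rewrite -[LHS]/(series _ N - series _ N) /series /= -sumrB; apply: eq_bigr => k _.
by rewrite -scalerBl (cintegral_sin_sqrt_difference he b_cont).
Qed.
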